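(* Let $n\geq 2$ be an integer. For $(u,v)=\langle z;p,q\rangle_{\epsilon_1,\epsilon_2}$ put $$\widehat{\mathcal L}_n(u,v)=\sum_{r=0}^{n-1}\frac{(-1)^r}{r!}\,\mathcal Li_{n-r}(z;q)\,u^r-\frac{(-1)^n}{n!}u^{n-1}v .$$ This function is holomorphic and well defined modulo $\frac{(2\pi i)^n}{(n-1)!}$ for $(u,v)\in\widehat{\mathbb C}_{++}$ or $\widehat{\mathbb C}_{+-}$, and modulo $\kappa_n\frac{(2\pi i)^n}{(n-1)!}$ for $(u,v)\in\widehat{\mathbb C}_{-+}$. It is a primitive for $\omega_n$, i.e. $d\widehat{\mathcal L}_n=\omega_n$, where $\omega_n=(-1)^n\frac{n-1}{n!}u^{n-2}(u\,dv-v\,du)$.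
   Context: For signs $\epsilon_1,\epsilon_2\in\{1,-1\}$ let $\widehat{\mathbb C}_{\epsilon_1\epsilon_2}=\{(u,v)\in\mathbb C^2 : \epsilon_1e^u+\epsilon_2e^v=1\}$ (subscripts are written as $+,-$). $\mathrm{Log}$ is the main branch of the logarithm (argument in $(-\pi,\pi]$), and $\mathrm{Li}_k$ is the main branch of the polylogarithm: $\mathrm{Li}_1(z)=-\mathrm{Log}(1-z)$, $\mathrm{Li}_k(z)=\int_0^1\frac{\mathrm{Li}_{k-1}(tz)}{t}dt$. Each $(u,v)\in\widehat{\mathbb C}_{\epsilon_1\epsilon_2}$ can be written uniquely as $$\langle z;p,q\rangle_{\epsilon_1,\epsilon_2}:=(\mathrm{Log}(\epsilon_1z)+2p\pi i,\ \mathrm{Log}(\epsilon_2(1-z))+2q\pi i),\qquad z\in\mathbb C\setminus\{0,1\},\ p,q\in\mathbb Z.$$ For $z\in\mathbb C\setminus\{0,1\}$ and $q\in\mathbb Z$, $\mathcal Li_k(z;q)=\mathrm{Li}_k(z)-\frac{2q\pi i}{(k-1)!}\mathrm{Log}(z)^{k-1}$. With $\nu_2$ the 2-adic valuation, $\kappa_n=2^{2-n}$ if $n$ is even and $\kappa_n=2^{3+\nu_2(n-1)-n}$ if $n$ is odd. ''Well defined modulo $c$'' means as a function with values in $\mathbb C/c\mathbb Z$. *)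

(* Defs.v *)
From mathcomp Require Import all_boot all_order all_algebra complex.
From mathcomp Require Import all_classical all_reals all_analysis.
From mathcomp Require Import ring lra.

Set Implicit Arguments.
Unset Strict Implicit.
Unset Printing Implicit Defensive.

Import numFieldNormedType.Exports.
Import Order.TTheory GRing.Theory Num.Theory.

Local Open Scope ring_scope.
Local Open Scope classical_set_scope.

(* Naming R[i] at numClosedFieldType is what lets inference find its normed
   topology; differentiability between normed spaces over [cplx R] is complex
   differentiability. *)
Definition cplx (R : realType) : numClosedFieldType := R[i].

Definition twopii (R : realType) : cplx R := (0 +i* (2 * pi))%C.

Definition cexp (R : realType) (z : cplx R) : cplx R :=
  (expR (complex.Re z) * cos (complex.Im z)
   +i* (expR (complex.Re z) * sin (complex.Im z)))%C.

(* Argument in ]-pi, pi]; only meaningful for z != 0. *)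
Definition cArg (R : realType) (z : cplx R) : R :=
  let t := acos (complex.Re z / Normc.normc z) in
  if 0 <= complex.Im z then t else - t.

Definition cLog (R : realType) (z : cplx R) : cplx R :=
  (ln (Normc.normc z) +i* cArg z)%C.

Definition cintegral01 (R : realType) (f : R -> cplx R) : cplx R :=
  ((\int[lebesgue_measure]_(t in `[0, 1]) complex.Re (f t))
   +i* (\int[lebesgue_measure]_(t in `[0, 1]) complex.Im (f t)))%C.

(* Index 0 is never used; Li_1 is the base case.  For k = 2 and real z > 1 the
   integrand has an integrable logarithmic singularity at t = 1 / z, hence the
   Lebesgue integral. *)
Fixpoint polylog (R : realType) (k : nat) (z : cplx R) : cplx R :=
  match k with
  | 0 => z / (1 - z)
  | 1 => - cLog (1 - z)
  | (k'.+1 as l).+1 =>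
      cintegral01 (fun t : R => polylog l ((t%:C)%C * z) / (t%:C)%C)
  end.

Definition polylogq (R : realType) (k : nat) (z : cplx R) (q : int) : cplx R :=
  polylog k z - (q%:~R * twopii R) / (k.-1)`!%:R * cLog z ^+ k.-1.

(* The signs e1, e2 are complex numbers, instantiated at 1 and -1. *)
Definition hatC_eq (R : realType) (e1 e2 : cplx R)
    (w : cplx R * cplx R) : cplx R :=
  e1 * cexp w.1 + e2 * cexp w.2.

Definition hatC (R : realType) (e1 e2 : cplx R) : set (cplx R * cplx R) :=
  [set w | hatC_eq e1 e2 w = 1].

Definition bracket (R : realType) (e1 e2 : cplx R) (x : cplx R * int * int) :
    cplx R * cplx R :=
  (cLog (e1 * x.1.1) + x.1.2%:~R * twopii R,
   cLog (e2 * (1 - x.1.1)) + x.2%:~R * twopii R).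

Lemma cexpD (R : realType) (x y : cplx R) : cexp (x + y) = cexp x * cexp y.
Proof.
case: x y => [a b] [c d]; rewrite /cexp /= expRD cosD sinD.
by apply/eqP; rewrite eq_complex /=; apply/andP; split; apply/eqP; ring.
Qed.

Lemma cexp0 (R : realType) : cexp (0 : cplx R) = 1.
Proof. by rewrite /cexp /= expR0 cos0 sin0 mul1r mulr0. Qed.

Lemma cexp_neq0 (R : realType) (x : cplx R) : cexp x != 0.
Proof.
apply/eqP => x0; have := cexpD x (- x); rewrite subrr cexp0 x0 mul0r.
by apply/eqP; rewrite oner_eq0.
Qed.

Lemma cexp_int (R : realType) (m : int) : cexp (m%:~R * twopii R) = 1.
Proof.
have e1 : cexp (twopii R) = 1.
  by rewrite /cexp /= expR0 mulr_natl cos2pi sin2pi mulr1 mulr0.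
have en (n : nat) : cexp (n%:R * twopii R) = 1.
  elim: n => [|n IHn]; first by rewrite mul0r cexp0.
  by rewrite -natr1 mulrDl mul1r cexpD IHn e1 mulr1.
case: m => n; first exact: en.
have := cexpD ((Negz n)%:~R * twopii R) (n.+1%:R * twopii R).
by rewrite en mulr1 NegzE mulrNz mulNr addNr cexp0.
Qed.

Lemma normc_cexp (R : realType) (x : cplx R) :
  Normc.normc (cexp x) = expR (complex.Re x).
Proof.
by rewrite /cexp /= !exprMn -mulrDr cos2Dsin2 mulr1 sqrtr_sqr ger0_norm // expR_ge0.
Qed.

Lemma cexp_eq1 (R : realType) (x : cplx R) : cexp x = 1 ->
  `|complex.Im x| < 2 * pi -> x = 0.
Proof.
move=> ex1 xlt; have := normc_cexp x; rewrite ex1 Normc.normc1.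
rewrite -[LHS]expR0 => /expR_inj re0.
move: ex1 xlt; case: x re0 => a b /= <-; rewrite /cexp /= expR0 !mul1r.
case=> cb sb; rewrite -(cos_norm b) in cb.
move=> blt; suff : `|b| = 0 by move/eqP; rewrite normr_eq0 => /eqP->.
apply/eqP; rewrite eq_le normr_ge0 andbT leNgt; apply/negP => b0.
have hh : `|b| = (`|b| / 2) *+ 2 by rewrite -mulr_natr divfK.
have : sin (`|b| / 2) ^+ 2 = 0.
  by move: cb; rewrite hh cos_mulr2n cos2sin2 -hh => h; lra.
apply/eqP; rewrite sqrf_eq0 gt_eqF // sin_gt0_pi //.
by rewrite divr_gt0 //= ltr_pdivrMr // mulrC.
Qed.

Lemma cexp_eqP (R : realType) (x y : cplx R) : cexp x = cexp y <->
  exists m : int, x = y + m%:~R * twopii R.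
Proof.
split=> [exy|[m ->]]; last by rewrite cexpD cexp_int mulr1.
have pi2 : 0 < 2 * pi :> R by rewrite mulr_gt0 // pi_gt0.
pose m := Num.floor (complex.Im (x - y) / (2 * pi)); exists m.
suff : x - y - m%:~R * twopii R = 0 by move/eqP; rewrite !subr_eq add0r addrC => /eqP.
have mE : m%:~R * twopii R = (0 +i* (m%:~R * (2 * pi)))%C :> cplx R.
  rewrite /twopii -[m%:~R](rmorph_int (real_complex R)).
  by apply/eqP; rewrite eq_complex /=; apply/andP; split; apply/eqP; ring.
apply: cexp_eq1.
  rewrite -mulNr -mulrNz cexpD cexp_int mulr1 cexpD exy -cexpD subrr.
  exact: cexp0.
have /andP[h1 h2] := floor_itv (complex.Im (x - y) / (2 * pi)).
rewrite -/m ler_pdivlMr // in h1; rewrite -/m ltr_pdivrMr // in h2.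
rewrite mE raddfB /= ger0_norm ?subr_ge0 //.
by rewrite ltrBlDl; move: h2; rewrite intrD mulrDl mul1r.
Qed.

Lemma normc_bound (R : realType) (z : cplx R) : z != 0 ->
  0 < Normc.normc z /\ -1 <= complex.Re z / Normc.normc z <= 1.
Proof.
move=> z0.
have r0 : 0 < Normc.normc z.
  rewrite lt_neqAle eq_sym; apply/andP; split.
    by apply: contra z0 => /eqP/Normc.eq0_normc ->.
  by case: (z) => a b; exact: sqrtr_ge0.
have zr : `|complex.Re z| <= Normc.normc z.
  by case: (z) => a b /=; rewrite -sqrtr_sqr ler_wsqrtr // lerDl sqr_ge0.
by split; rewrite // ler_pdivlMr // ler_pdivrMr // mulN1r mul1r -ler_norml.
Qed.

Lemma cArg_itv (R : realType) (z : cplx R) : z != 0 -> - pi < cArg z <= pi.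
Proof.
move=> z0; have pi0 := pi_gt0 R.
have [r0 bnd] := normc_bound z0.
rewrite /cArg; case: ifP => im0.
  rewrite acos_lepi // andbT (lt_le_trans _ (acos_ge0 _)) //; lra.
have reN : complex.Re z / Normc.normc z != -1.
  apply/eqP => e; move/negbT: im0; rewrite -ltNge => im0.
  have {e} : complex.Re z = - Normc.normc z.
    by rewrite -[LHS](divfK (lt0r_neq0 r0)) e mulN1r.
  case: (z) im0 => a b /= b0 e.
  have : a ^+ 2 = a ^+ 2 + b ^+ 2.
    by rewrite {1}e sqrrN sqr_sqrtr // addr_ge0 ?sqr_ge0.
  have b2 : 0 < b ^+ 2 by rewrite exprn_even_gt0 //= lt_eqF.
  lra.
have := acos_ge0 bnd; have : acos (complex.Re z / Normc.normc z) < pi.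
  by apply: acos_ltpi; rewrite lt_neqAle eq_sym reN.
by move=> ? ?; apply/andP; split; lra.
Qed.

Lemma cLogK (R : realType) (z : cplx R) : z != 0 -> cexp (cLog z) = z.
Proof.
move=> z0.
have [r0 bnd] := normc_bound z0.
have cA : cos (cArg z) = complex.Re z / Normc.normc z.
  by rewrite /cArg; case: ifP; rewrite ?cosN acosK.
have sA : Normc.normc z * sin (cArg z) = complex.Im z.
  have sq : Normc.normc z * Num.sqrt (1 - (complex.Re z / Normc.normc z) ^+ 2)
      = `|complex.Im z|.
    rewrite -[Normc.normc z in LHS](ger0_norm (ltW r0)) -[X in X * _]sqrtr_sqr.
    have nr : Normc.normc z != 0 by rewrite gt_eqF.
    rewrite -sqrtrM ?sqr_ge0 // mulrBr mulr1 -exprMn (ger0_norm (ltW r0)) mulrCA divff // mulr1.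
    have -> : Normc.normc z ^+ 2 = complex.Re z ^+ 2 + complex.Im z ^+ 2.
      by case: (z) => a b /=; rewrite sqr_sqrtr // addr_ge0 ?sqr_ge0.
    by rewrite addrC addKr sqrtr_sqr.
  rewrite /cArg; case: ifP => im0; rewrite ?sinN ?mulrN sin_acos // sq.
    by rewrite ger0_norm.
  by move/negbT: im0; rewrite -ltNge => /ltW im0; rewrite ler0_norm // opprK.
rewrite /cLog /cexp /= lnK ?posrE // sA cA mulrC divfK ?gt_eqF //.
by case: (z).
Qed.

Lemma bracket_bij (R : realType) (e1 e2 : cplx R)
    (he1 : e1 ^+ 2 = 1) (he2 : e2 ^+ 2 = 1) :
  (forall x, x.1.1 != 0 -> x.1.1 != 1 -> hatC e1 e2 (bracket e1 e2 x)) /\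
  (forall w, hatC e1 e2 w -> exists! x,
     [/\ x.1.1 != 0, x.1.1 != 1 & bracket e1 e2 x = w]).
Proof.
have e10 : e1 != 0 by apply/eqP => e; move/eqP: he1; rewrite e expr0n eq_sym oner_eq0.
have e20 : e2 != 0 by apply/eqP => e; move/eqP: he2; rewrite e expr0n eq_sym oner_eq0.
have K1 t : e1 * (e1 * t) = t by rewrite mulrA -expr2 he1 mul1r.
have K2 t : e2 * (e2 * t) = t by rewrite mulrA -expr2 he2 mul1r.
have E1 (z : cplx R) (p : int) : z != 0 ->
    cexp (cLog (e1 * z) + p%:~R * twopii R) = e1 * z.
  by move=> z0; rewrite cexpD cexp_int mulr1 cLogK // mulf_neq0.
have E2 (z : cplx R) (q : int) : z != 1 ->
    cexp (cLog (e2 * (1 - z)) + q%:~R * twopii R) = e2 * (1 - z).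
  move=> z1; rewrite cexpD cexp_int mulr1 cLogK // mulf_neq0 // subr_eq0.
  by rewrite eq_sym.
have tp0 : twopii R != 0.
  by rewrite eq_complex /= eqxx /= mulf_neq0 // gt_eqF // pi_gt0.
split=> [[[z p] q] /= z0 z1|[u v]].
  by rewrite /hatC /hatC_eq /= E1 // E2 // K1 K2 addrC subrK.
rewrite /hatC /hatC_eq /= => huv.
pose z := e1 * cexp u.
have z0 : z != 0 by rewrite mulf_neq0 // cexp_neq0.
have zE : 1 - z = e2 * cexp v by rewrite -huv /z addrC addKr.
have z1 : z != 1.
  by rewrite eq_sym -subr_eq0 zE mulf_neq0 // cexp_neq0.
have /cexp_eqP[p up] : cexp u = cexp (cLog (e1 * z)).
  by rewrite cLogK ?mulf_neq0 ?cexp_neq0 // /z K1.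
have /cexp_eqP[q vq] : cexp v = cexp (cLog (e2 * (1 - z))).
  by rewrite cLogK ?zE ?K2 // cexp_neq0.
exists (z, p, q); split => [|[[z' p'] q'] /= [z'0 z'1 [hu hv]]].
  by split => //=; rewrite /bracket /= -up -vq.
have ez : z' = z by rewrite /z -hu E1 // K1.
subst z'; congr (_, _, _); apply/(@intr_inj (cplx R))/(mulIf tp0).
  by apply: (addrI (cLog (e1 * z))); rewrite -up hu.
by apply: (addrI (cLog (e2 * (1 - z)))); rewrite -vq hv.
Qed.

(* The (z, p, q) with w = <z; p, q>; see [bracket_bij]. *)
Definition coords (R : realType) (e1 e2 : cplx R) (w : cplx R * cplx R) :
    cplx R * int * int :=
  xget (0, 0, 0)
    [set x | [/\ x.1.1 != 0, x.1.1 != 1 & bracket e1 e2 x = w]].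

Definition hatL (R : realType) (e1 e2 : cplx R) (n : nat)
    (w : cplx R * cplx R) : cplx R :=
  let: (z, _, q) := coords e1 e2 w in
  \sum_(0 <= r < n) (-1) ^+ r / r`!%:R * polylogq (n - r) z q * w.1 ^+ r
  - (-1) ^+ n / n`!%:R * w.1 ^+ n.-1 * w.2.

(* The value at w of a 1-form on C^2, as a function of the tangent vector h. *)
Definition omega (R : realType) (n : nat) (w h : cplx R * cplx R) : cplx R :=
  (-1) ^+ n * (n.-1)%:R / n`!%:R * w.1 ^+ (n - 2)
  * (w.1 * h.2 - w.2 * h.1).

Definition kappa (R : realType) (n : nat) : cplx R :=
  if odd n then 2 ^ (3 + (logn 2 n.-1)%:Z - n%:Z) else 2 ^ (2 - n%:Z).

Definition eqmodZ (R : realType) (c a b : cplx R) : Prop :=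
  exists m : int, a - b = m%:~R * c.

(* G is holomorphic on a neighbourhood of w in C^2 and, on the points of the
   curve there, is a lift of f : hatC e1 e2 -> C / cZ. *)
Definition holomorphic_lift (R : realType) (e1 e2 c : cplx R)
    (f : cplx R * cplx R -> cplx R) (w : cplx R * cplx R)
    (G : cplx R * cplx R -> cplx R) : Prop :=
  (\forall x \near w, differentiable G x) /\
  (\forall x \near w, hatC e1 e2 x -> eqmodZ c (f x) (G x)).

(* The curve being a closed submanifold of C^2, its holomorphic functions are
   locally the restrictions of holomorphic functions of (u, v). *)
Definition holomorphic_mod (R : realType) (e1 e2 c : cplx R)
    (f : cplx R * cplx R -> cplx R) : Prop :=
  forall w, hatC e1 e2 w -> exists G, holomorphic_lift e1 e2 c f w G.

Definition tangent (R : realType) (e1 e2 : cplx R) (w : cplx R * cplx R) :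
    set (cplx R * cplx R) :=
  [set h | 'd (hatC_eq e1 e2) w h = 0].

(* df = om on the curve, df being the differential of the local lifts of f. *)
Definition primitive_mod (R : realType) (e1 e2 c : cplx R)
    (f : cplx R * cplx R -> cplx R)
    (om : cplx R * cplx R -> cplx R * cplx R -> cplx R) : Prop :=
  forall w, hatC e1 e2 w -> exists2 G, holomorphic_lift e1 e2 c f w G &
    \forall x \near w, hatC e1 e2 x ->
      forall h, tangent e1 e2 x h -> 'd G x h = om x h.

(* Main.v *)
Require Import Defs.
From mathcomp Require Import all_boot all_order all_algebra complex.
From mathcomp Require Import all_classical all_reals all_analysis.
From mathcomp Require Import measurable_realfun zify ring lra.
Import numFieldNormedType.Exports.
Import Order.TTheory GRing.Theory Num.Theory.
Local Open Scope ring_scope.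

(** Write z = e1 e^u on the curve e1 e^u + e2 e^v = 1.  If the Li_k are replaced,
near a point, by holomorphic branches F_k with F_1' = 1 / (1 - z) and
F_(k+1)' = F_k / z, then the derivative in u of
sum_r (-1)^r / r! F_(n-r)(z) u^r telescopes to
(-1)^(n-1) / (n-1)! z / (1 - z) u^(n-1) ([lift_sum_derive]).  On the curve,
z du + (1 - z) dv = 0, and the differential of the whole function becomes
omega_n.  So the point is to compare the principal branches, with their
correction by q, to such branches F_k.

Two changes are to be controlled: that of q, and that of Li_k when z crosses
]1, +oo[.  Both add to Li_k an integer multiple of 2 pi i Log(z)^(k-1) / (k-1)!
([jump]), and by the binomial theorem ([binomial_jump]) a change of all the
Li_k by N such jumps changes the function by
N 2 pi i / (n-1)! (Log z - u)^(n-1).  When e1 = 1, Log z - u is a multiple of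
2 pi i and this is an integer multiple of (2 pi i)^n / (n-1)!
([primitive_hatL_pos]).  When e1 = -1, Log z - u = m pi i with m odd, and
e2 = 1 makes the total N = q - (number of jumps) continuous along the curve,
hence locally constant; the variation is then
N (m^(n-1) - 1) 2^(1-n) (2 pi i)^n / (n-1)!, and the power of 2 that divides
m^(n-1) - 1 for every odd m gives kappa_n ([int_odd_pow_sub1],
[primitive_hatL_neg]).

The analysis goes into the local branches ([local_branch]).  Off [1, +oo[,
Li_k(z) / z is the average of Li_(k-1)(t z) / (t z) over t in [0, 1], and a
second-order Taylor estimate that is uniform along rays passes to such averages
([rayC2_rayint]); this gives the derivatives of all Li_k, and those of Log and
exp ([polylog_derive], [cLog_derive], [cexp_derive]).  Across the cut, the
inversion formula provides the continuation: for Re z > 1 the function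
-(-1)^k Li_k(1/z) + (polynomial in Log z) is holomorphic and satisfies the same
differential equations as Li_k ([cont_polylog_derive]).  It coincides with Li_k
below and on the cut, and with Li_k minus one jump above it
([cont_polylog_lower], [cont_polylog_upper]).  The constants of integration are
identified at z = 2: by dominated convergence the integrals that define Li_k on
the cut are its limits from below ([polylog_bdry]), by conjugation the limits
from above are the conjugate numbers, and the imaginary part on the cut is
computed by integrating powers of ln ([Im_polylog_cut]). *)

Set Implicit Arguments.
Unset Strict Implicit.
Unset Printing Implicit Defensive.

Local Open Scope classical_set_scope.

Local Notation normc := Normc.normc.
Local Notation Re := complex.Re.
Local Notation Im := complex.Im.
Local Notation "t %:K" := ((t%:C)%C : cplx _) (at level 2, format "t %:K") : ring_scope.

(** * Modulus, neighbourhoods and derivatives in the complex plane *)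

Section ComplexPlane.
Variable R : realType.
Implicit Types (x y z w : cplx R) (t r : R).

Lemma cplx_norm x : `|x| = (normc x)%:K.
Proof. by case: x. Qed.

Lemma normcD x y : normc (x + y) <= normc x + normc y.
Proof. exact: le_normcD. Qed.

Lemma normcN x : normc (- x) = normc x.
Proof. exact: complex.normcN. Qed.

Lemma normcBC x y : normc (x - y) = normc (y - x).
Proof. by rewrite -normcN opprB. Qed.

Lemma normc_ge0 x : 0 <= normc x.
Proof. by case: x => a b; exact: sqrtr_ge0. Qed.

Lemma normcB x y : normc (x - y) <= normc x + normc y.
Proof. by rewrite -(normcN y) normcD. Qed.

Lemma normc_eq0 x : (normc x == 0) = (x == 0).
Proof.
apply/eqP/eqP => [/Normc.eq0_normc//|->].
by rewrite -[LHS]/(Normc.normc (0 : R[i])) Normc.normc0.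
Qed.

Lemma normc_gt0 x : (0 < normc x) = (x != 0).
Proof. by rewrite lt0r normc_eq0 normc_ge0 andbT. Qed.

Lemma normc_0 : normc (0 : cplx R) = 0.
Proof. by apply/eqP; rewrite normc_eq0. Qed.

Lemma normc_1 : normc (1 : cplx R) = 1.
Proof. exact: Normc.normc1. Qed.

Lemma normcM x y : normc (x * y) = normc x * normc y.
Proof. exact: Normc.normcM. Qed.

Lemma normcV x : normc x^-1 = (normc x)^-1.
Proof. exact: Normc.normcV. Qed.

Lemma normcX x n : normc (x ^+ n) = normc x ^+ n.
Proof.
elim: n => [|n IH]; first by rewrite !expr0 normc_1.
by rewrite !exprS normcM IH.
Qed.

Lemma normcR t : normc t%:K = `|t|.
Proof. by rewrite /= expr0n addr0 sqrtr_sqr. Qed.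

Lemma normRe_le x : `|Re x| <= normc x.
Proof. by case: x => a b /=; rewrite -sqrtr_sqr ler_wsqrtr // lerDl sqr_ge0. Qed.

Lemma normIm_le x : `|Im x| <= normc x.
Proof. by case: x => a b /=; rewrite -sqrtr_sqr ler_wsqrtr // lerDr sqr_ge0. Qed.

Lemma normc_leD x : normc x <= `|Re x| + `|Im x|.
Proof.
case: x => a b /=; rewrite -[leRHS]ger0_norm ?addr_ge0// -sqrtr_sqr ler_wsqrtr//.
by rewrite sqrrD !real_normK ?num_real// lerD2r lerDl mulrn_wge0 ?mulr_ge0.
Qed.

Lemma sqr_normc_ReIm x : normc x ^+ 2 = Re x ^+ 2 + Im x ^+ 2.
Proof. by case: x => a b; rewrite /= sqr_sqrtr// addr_ge0 ?sqr_ge0. Qed.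

Lemma cplx_eq x y : Re x = Re y -> Im x = Im y -> x = y.
Proof. by case: x y => a b [c d] /= -> ->. Qed.

Lemma ReD x y : Re (x + y) = Re x + Re y. Proof. exact: raddfD. Qed.
Lemma ImD x y : Im (x + y) = Im x + Im y. Proof. exact: raddfD. Qed.
Lemma ReN x : Re (- x) = - Re x. Proof. exact: raddfN. Qed.
Lemma ImN x : Im (- x) = - Im x. Proof. exact: raddfN. Qed.
Lemma ReB x y : Re (x - y) = Re x - Re y. Proof. exact: raddfB. Qed.
Lemma ImB x y : Im (x - y) = Im x - Im y. Proof. exact: raddfB. Qed.
Lemma ReM x y : Re (x * y) = Re x * Re y - Im x * Im y.
Proof. by case: x y => a b []. Qed.
Lemma ImM x y : Im (x * y) = Re x * Im y + Im x * Re y.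
Proof. by case: x y => a b []. Qed.
Lemma ReZ t x : Re (t%:K * x) = t * Re x.
Proof. by rewrite ReM /= mul0r subr0. Qed.
Lemma ImZ t x : Im (t%:K * x) = t * Im x.
Proof. by rewrite ImM /= mul0r addr0. Qed.

(** The norm of [cplx R] takes its values in [cplx R]; here and below,
    neighbourhoods, derivatives and continuity are brought back to real radii. *)
Lemma nbhs_normcP z (P : set (cplx R)) : nbhs z P <->
  exists2 d : R, 0 < d & forall w, normc (w - z) < d -> P w.
Proof.
split=> [/nbhs_ballP[e /= e0 eP]|[d d0 dP]].
  have eE : e = (Re e)%:K.
    by apply: cplx_eq => //=; move: e0; rewrite ltcE => /andP[/eqP].
  exists (Re e); first by move: e0; rewrite eE ltcR.
  by move=> w wz; apply: eP; rewrite /ball/= cplx_norm normcBC eE ltcR.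
apply/nbhs_ballP; exists d%:K => /=; first by rewrite ltcR.
by move=> w; rewrite /ball/= cplx_norm ltcR normcBC => /dP.
Qed.

Lemma is_derive_normc (f : cplx R -> cplx R) z l :
  (forall e : R, 0 < e -> exists2 d : R, 0 < d & forall w, normc (w - z) < d ->
     normc (f w - f z - (w - z) * l) <= e * normc (w - z)) <->
  is_derive z 1 f l.
Proof.
split=> [H|].
  have cv : (fun h : cplx R => h^-1 *: (f (h *: 1 + z) - f z)) @ 0^' --> l.
    apply/cvgrPdist_le => e e0; rewrite ?near_simpl.
    have eE : e = (Re e)%:K.
      by apply: cplx_eq => //=; move: e0; rewrite ltcE => /andP[/eqP].
    rewrite eE ltcR in e0; have [d d0 dP] := H _ e0.
    apply/nbhs_normcP; exists d => // h; rewrite subr0 => hd /= h0.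
    have {}dP := dP (h + z); rewrite addrK in dP; have {}dP := dP hd.
    rewrite cplx_norm eE lecR normcBC.
    have -> : h^-1 *: (f (h *: 1 + z) - f z) - l = h^-1 * (f (h + z) - f z - h * l).
      by rewrite /GRing.scale/= mulr1 [in RHS]mulrBr mulKf.
    by rewrite normcM normcV ler_pdivrMl ?normc_gt0// [leRHS]mulrC.
  by split; [exact: (cvgP l cv) | exact: (cvg_lim _ cv)].
move=> [dv <-] e e0.
have /cvgrPdist_le/(_ e%:K) : (fun h : cplx R => h^-1 *: (f (h *: 1 + z) - f z)) @ 0^' --> 'D_1 f z.
  exact: dv.
rewrite ltcR => /(_ e0); rewrite ?near_simpl => /nbhs_normcP[d d0 dP].
exists d => // w wd; have [->|wz] := eqVneq w z.
  by rewrite !subrr mul0r subrr normc_0 mulr0.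
have := dP (w - z); rewrite subr0 subr_eq0 => /(_ wd wz).
rewrite cplx_norm lecR normcBC /GRing.scale/= mulr1 subrK.
set D := 'D_1 f z.
have -> : D - (w - z)^-1 * (f w - f z) = (w - z)^-1 * ((w - z) * D - (f w - f z)).
  by rewrite [in RHS]mulrBr mulKf ?subr_eq0.
by rewrite normcM normcV ler_pdivrMl ?normc_gt0 ?subr_eq0// [leRHS]mulrC.
Qed.

Lemma is_derive_sqr (f : cplx R -> cplx R) z l (M d : R) : 0 < d ->
  (forall w, normc (w - z) < d ->
     normc (f w - f z - (w - z) * l) <= M * normc (w - z) ^+ 2) ->
  is_derive z 1 f l.
Proof.
move=> d0 H; apply/is_derive_normc => e e0.
pose M' := `|M| + 1; have M'0 : 0 < M' by rewrite ltr_wpDl.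
exists (Num.min d (e / M')); first by rewrite lt_min d0 divr_gt0.
move=> w; rewrite lt_min => /andP[wd we].
apply: (le_trans (H _ wd)); rewrite expr2 mulrA ler_wpM2r ?normc_ge0//.
apply: (@le_trans _ _ (M' * normc (w - z))).
  by rewrite ler_wpM2r ?normc_ge0// ler_wpDr// ler_norm.
by rewrite mulrC -ler_pdivlMr// ltW.
Qed.

Lemma continuous_normcP (f : cplx R -> cplx R) z :
  (forall e : R, 0 < e -> exists2 d : R, 0 < d & forall w, normc (w - z) < d ->
     normc (f w - f z) < e) <-> {for z, continuous f}.
Proof.
rewrite /prop_for /continuous_at; split=> [H|/(@cvgrPdist_lt _ _ _ (nbhs z)) H e e0].
  apply/(@cvgrPdist_lt _ _ _ (nbhs z)) => e e0; rewrite ?near_simpl.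
  have eE : e = (Re e)%:K.
    by apply: cplx_eq => //=; move: e0; rewrite ltcE => /andP[/eqP].
  rewrite eE ltcR in e0; have [d d0 dP] := H _ e0.
  by apply/nbhs_normcP; exists d => // w /dP; rewrite cplx_norm eE ltcR normcBC.
have := H e%:K; rewrite ltcR => /(_ e0); rewrite ?near_simpl => /nbhs_normcP[d d0 dP].
by exists d => // w /dP; rewrite cplx_norm ltcR normcBC.
Qed.

End ComplexPlane.

(** * Segments and integrals over the unit interval *)

Section PathsAndIntegrals.
Variable R : realType.
Implicit Types (x y z w a b : cplx R) (t r : R).
Local Notation mu := (@lebesgue_measure R).

Lemma is_derive_real (g : R -> R) t l :
  (forall e : R, 0 < e -> exists2 d : R, 0 < d & forall s, `|s - t| < d ->
     `|g s - g t - (s - t) * l| <= e * `|s - t|) -> is_derive t 1 g l.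
Proof.
move=> H.
have cv : (fun h : R => h^-1 *: (g (h *: 1 + t) - g t)) @ 0^' --> l.
  apply/cvgrPdist_le => e e0; have [d d0 dP] := H _ e0.
  apply/nbhs_ballP; exists d => //= h; rewrite /ball/= sub0r normrN => hd h0.
  have := dP (h + t); rewrite addrK => /(_ hd).
  rewrite /GRing.scale/= mulr1 distrC => dP'.
  have -> : l - h^-1 * (g (h + t) - g t) = h^-1 * (h * l - (g (h + t) - g t)).
    by rewrite [in RHS]mulrBr mulKf.
  by rewrite normrM normfV ler_pdivrMl ?normr_gt0// [leRHS]mulrC.
by split; [exact: (cvgP l cv) | exact: (cvg_lim _ cv)].
Qed.

Lemma continuous_real (g : R -> R) t :
  (forall e : R, 0 < e -> exists2 d : R, 0 < d & forall s, `|s - t| < d ->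
     `|g s - g t| < e) -> {for t, continuous g}.
Proof.
move=> H; apply/(@cvgrPdist_lt _ _ _ (nbhs t)) => e e0.
have [d d0 dP] := H _ e0.
by apply/nbhs_ballP; exists d => //= s; rewrite /ball/= distrC => /dP; rewrite distrC.
Qed.

Lemma Re_subZ x t y : Re x - t * Re y = Re (x - t%:K * y).
Proof. by rewrite ReB ReZ. Qed.

Lemma Im_subZ x t y : Im x - t * Im y = Im (x - t%:K * y).
Proof. by rewrite ImB ImZ. Qed.

Lemma is_derive_line (f : cplx R -> cplx R) a b t l :
  is_derive (a + t%:K * b) 1 f l ->
  is_derive t 1 (fun s => Re (f (a + s%:K * b))) (Re (b * l)) /\
  is_derive t 1 (fun s => Im (f (a + s%:K * b))) (Im (b * l)).
Proof.
move=> /is_derive_normc df.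
have K (e : R) : 0 < e -> exists2 d : R, 0 < d & forall s, `|s - t| < d ->
    normc (f (a + s%:K * b) - f (a + t%:K * b) - (s - t)%:K * (b * l))
     <= e * `|s - t|.
  move=> e0; pose B := normc b + 1.
  have B0 : 0 < B by rewrite ltr_wpDl ?normc_ge0.
  have [d d0 dP] := df (e / B) (divr_gt0 e0 B0).
  exists (d / B); first exact: divr_gt0.
  move=> s; rewrite ltr_pdivlMr// => sd.
  have st : a + s%:K * b - (a + t%:K * b) = (s - t)%:K * b.
    by rewrite rmorphB; ring.
  have nst : normc ((s - t)%:K * b) <= `|s - t| * B.
    by rewrite normcM normcR ler_wpM2l// lerDl.
  have := dP (a + s%:K * b); rewrite st -[(s - t)%:K * b * l]mulrA => /(_ (le_lt_trans nst sd)).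
  move=> /le_trans; apply.
  rewrite -mulrA ler_wpM2l ?(ltW e0)//.
  by rewrite mulrC ler_pdivrMr.
split; apply: is_derive_real => e e0; have [d d0 dP] := K e e0;
  exists d => // s sd; apply: le_trans (dP s sd).
  by rewrite -ReB Re_subZ normRe_le.
by rewrite -ImB Im_subZ normIm_le.
Qed.

(** Asked of the two real components, since the integral is defined
    componentwise. *)
Definition cpath (f : R -> cplx R) := forall t, 0 <= t <= 1 ->
  {for t, continuous (fun s => Re (f s))} /\
  {for t, continuous (fun s => Im (f s))}.

Lemma cpath_line (f : cplx R -> cplx R) a b :
  (forall t, 0 <= t <= 1 -> {for a + t%:K * b, continuous f}) ->
  cpath (fun t => f (a + t%:K * b)).
Proof.
move=> cf t t01; have /continuous_normcP {}cf := cf t t01.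
have K (e : R) : 0 < e -> exists2 d : R, 0 < d & forall s, `|s - t| < d ->
    normc (f (a + s%:K * b) - f (a + t%:K * b)) < e.
  move=> e0; pose B := normc b + 1.
  have B0 : 0 < B by rewrite ltr_wpDl ?normc_ge0.
  have [d d0 dP] := cf e e0.
  exists (d / B); first exact: divr_gt0.
  move=> s; rewrite ltr_pdivlMr// => sd; apply: dP.
  have -> : a + s%:K * b - (a + t%:K * b) = (s - t)%:K * b.
    by rewrite rmorphB; ring.
  by apply: le_lt_trans sd; rewrite normcM normcR ler_wpM2l// lerDl.
split; apply: continuous_real => e e0; have [d d0 dP] := K e e0;
  exists d => // s sd; apply: le_lt_trans (dP s sd).
  by rewrite -ReB normRe_le.
by rewrite -ImB normIm_le.
Qed.

(** There is no mean value theorem for complex values: it is applied to the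
    real and the imaginary part along the segment. *)
Lemma derive0_line (f : cplx R -> cplx R) a b :
  (forall t, 0 <= t <= 1 -> is_derive (a + t%:K * b) 1 f 0) -> f (a + b) = f a.
Proof.
move=> df.
have K (g : R -> R) : (forall t, 0 <= t <= 1 -> is_derive t 1 g 0) -> g 1 = g 0.
  move=> dg; have [||c _] := @MVT_segment R g (fun=> 0) 0 1 ler01.
  - by move=> t; rewrite in_itv/= => /andP[/ltW t0 /ltW t1]; apply: dg; rewrite t0.
  - apply: derivable_within_continuous => t; rewrite in_itv/= => t01.
    by have [] := dg t t01.
  by move/eqP; rewrite mul0r subr_eq0 => /eqP.
have E0 : a + (0:R)%:K * b = a by rewrite mul0r addr0.
have E1 : a + (1:R)%:K * b = a + b by rewrite mul1r.
rewrite -{1}E1 -{2}E0; apply: cplx_eq.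
  apply: (K (fun s => Re (f (a + s%:K * b)))) => t /df /is_derive_line[+ _].
  by rewrite mulr0.
apply: (K (fun s => Im (f (a + s%:K * b)))) => t /df /is_derive_line[_].
by rewrite mulr0.
Qed.

Lemma measurable01 : measurable (`[(0 : R), 1] : set (measurableTypeR R)).
Proof. exact: measurable_itv. Qed.

Definition cintegrable (f : R -> cplx R) :=
  mu.-integrable `[0, 1] (EFin \o (fun t => Re (f t))) /\
  mu.-integrable `[0, 1] (EFin \o (fun t => Im (f t))).

Lemma cintegrable_path f : cpath f -> cintegrable f.
Proof.
move=> cf; split; apply: continuous_compact_integrable; first exact: segment_compact.
- by apply: continuous_in_subspaceT => t /[!inE]/=; rewrite in_itv/= => /cf[].
- exact: segment_compact.
- by apply: continuous_in_subspaceT => t /[!inE]/=; rewrite in_itv/= => /cf[].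
Qed.

Lemma integrable01_cst (c : R) : mu.-integrable `[0, 1] (EFin \o (fun=> c)).
Proof.
apply: continuous_compact_integrable; first exact: segment_compact.
by apply: continuous_subspaceT => t; exact: cst_continuous.
Qed.

Lemma Rint01_cst (c : R) : \int[mu]_(t in `[0, 1]) c = c.
Proof.
by rewrite Rintegral_cst//= lebesgue_measure_itv/= lte_fin ltr01 sube0/= mulr1.
Qed.

Lemma cintegrableD f g : cintegrable f -> cintegrable g ->
  cintegrable (fun t => f t + g t).
Proof.
move=> [rf mf] [rg mg]; split.
  have := integrableD measurable01 rf rg.
  by apply: eq_integrable => // t _; rewrite /= ReD EFinD.
have := integrableD measurable01 mf mg.
by apply: eq_integrable => // t _; rewrite /= ImD EFinD.
Qed.

Lemma cintegrableZ c f : cintegrable f -> cintegrable (fun t => c * f t).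
Proof.
move=> [rf mf].
have Z (k : R) (h : R -> R) : mu.-integrable `[0, 1] (EFin \o h) ->
    mu.-integrable `[0, 1] (EFin \o (fun t => k * h t)).
  move=> ih; have := integrableZl measurable01 k ih.
  by apply: eq_integrable => // t _; rewrite /= EFinM.
split.
  have := integrableB measurable01 (Z (Re c) _ rf) (Z (Im c) _ mf).
  by apply: eq_integrable => // t _; rewrite /= ReM EFinB.
have := integrableD measurable01 (Z (Re c) _ mf) (Z (Im c) _ rf).
by apply: eq_integrable => // t _; rewrite /= ImM EFinD.
Qed.

Lemma cintegrableB f g : cintegrable f -> cintegrable g ->
  cintegrable (fun t => f t - g t).
Proof.
move=> fi /(cintegrableZ (-1)) gi; have := cintegrableD fi gi.
by under [X in cintegrable X]funext do rewrite mulN1r.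
Qed.

Lemma cintD f g : cintegrable f -> cintegrable g ->
  cintegral01 (fun t => f t + g t) = cintegral01 f + cintegral01 g.
Proof.
move=> [rf mf] [rg mg]; apply: cplx_eq; rewrite ?ReD ?ImD /=.
  by under eq_Rintegral do rewrite ReD; rewrite RintegralD.
by under eq_Rintegral do rewrite ImD; rewrite RintegralD.
Qed.

Lemma cintZ c f : cintegrable f ->
  cintegral01 (fun t => c * f t) = c * cintegral01 f.
Proof.
move=> [rf mf].
have Z (k : R) (h : R -> R) : mu.-integrable `[0, 1] (EFin \o h) ->
    mu.-integrable `[0, 1] (EFin \o (fun t => k * h t)).
  move=> ih; have := integrableZl measurable01 k ih.
  by apply: eq_integrable => // t _; rewrite /= EFinM.
apply: cplx_eq; rewrite ?ReM ?ImM /=.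
  under eq_Rintegral do rewrite ReM; rewrite RintegralB//; [|exact: Z..].
  by rewrite !RintegralZl.
under eq_Rintegral do rewrite ImM; rewrite RintegralD//; [|exact: Z..].
by rewrite !RintegralZl.
Qed.

Lemma cintB f g : cintegrable f -> cintegrable g ->
  cintegral01 (fun t => f t - g t) = cintegral01 f - cintegral01 g.
Proof.
move=> fi gi; have := cintD fi (cintegrableZ (-1) gi).
rewrite cintZ// mulN1r => <-; congr cintegral01.
by apply/funext => t; rewrite mulN1r.
Qed.

Lemma le_norm_cint_fun f (B : R -> R) : cintegrable f ->
  mu.-integrable `[0, 1] (EFin \o B) ->
  (forall t, 0 <= t <= 1 -> normc (f t) <= B t) ->
  normc (cintegral01 f) <= 2 * \int[mu]_(t in `[0, 1]) B t.
Proof.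
move=> [rf mf] iB fB; apply: (le_trans (normc_leD _)).
have Z (h : R -> R) : mu.-integrable `[0, 1] (EFin \o h) ->
    (forall t, 0 <= t <= 1 -> `|h t| <= B t) ->
    `|\int[mu]_(t in `[0, 1]) h t| <= \int[mu]_(t in `[0, 1]) B t.
  move=> ih hB; apply: (le_trans (le_normr_Rintegral measurable01 ih)).
  have nh : mu.-integrable `[0, 1] (EFin \o (fun t => `|h t|)).
    exact: (integrable_norm ih).
  apply: (le_Rintegral measurable01 nh iB) => t /=.
  by rewrite in_itv/=; exact: hB.
rewrite mulr_natl mulr2n; apply: lerD => /=; apply: Z => // t t01.
  exact: le_trans (normRe_le _) (fB t t01).
exact: le_trans (normIm_le _) (fB t t01).
Qed.

Lemma le_norm_cint f (B : R) : cintegrable f ->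
  (forall t, 0 <= t <= 1 -> normc (f t) <= B) ->
  normc (cintegral01 f) <= 2 * B.
Proof.
move=> fi fB; rewrite -[X in 2 * X]Rint01_cst.
by apply: le_norm_cint_fun => //; exact: integrable01_cst.
Qed.

(** The point 0 is excluded because the integrand Li_k(t z) / t of the next
    polylogarithm is a division by zero there. *)
Lemma eq_cint f g : cintegrable g ->
  (forall t, 0 < t <= 1 -> f t = g t) ->
  cintegrable f /\ cintegral01 f = cintegral01 g.
Proof.
move=> [rg mg] fg.
have Z (h k : R -> R) : mu.-integrable `[0, 1] (EFin \o k) ->
    (forall t, 0 < t <= 1 -> h t = k t) ->
    mu.-integrable `[0, 1] (EFin \o h) /\
    \int[mu]_(t in `[0, 1]) h t = \int[mu]_(t in `[0, 1]) k t.
  move=> ik hk.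
  have ik' : mu.-integrable `]0, 1] (EFin \o k).
    by apply: integrableS ik => //; apply: subset_itv; rewrite bnd_simp.
  have ih' : mu.-integrable `]0, 1] (EFin \o h).
    apply: eq_integrable ik' => // t /[!inE]/=; rewrite in_itv/= => /hk.
    by move=> ->.
  split; last first.
    rewrite -!Rintegral_itv_obnd_cbnd//; apply: eq_Rintegral => t /[!inE]/=.
    by rewrite in_itv/=; exact: hk.
  apply/integrableP; split.
    rewrite -(@setU1itv _ _ _ _ false) ?bnd_simp//; apply/measurable_funU => //; split.
      exact: measurable_fun_set1.
    exact: measurable_int ih'.
  rewrite -integral_itv_obnd_cbnd; first by case/integrableP: ih'.
  by case/integrableP: (integrable_abse ih').
have [ri re] := Z _ _ rg (fun t t01 => congr1 (@complex.Re R) (fg t t01)).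
have [mi me] := Z _ _ mg (fun t t01 => congr1 (@complex.Im R) (fg t t01)).
by split=> //; apply: cplx_eq.
Qed.

Lemma Rint01_FTC (F f : R -> R) :
  (forall t, 0 <= t <= 1 -> {for t, continuous f}) ->
  (forall t, 0 <= t <= 1 -> is_derive t 1 F (f t)) ->
  \int[mu]_(t in `[0, 1]) f t = F 1 - F 0.
Proof.
move=> cf dF.
have cF t : 0 <= t <= 1 -> {for t, continuous F}.
  by move=> /dF[/derivable1_diffP/differentiable_continuous].
rewrite /Rintegral (continuous_FTC2 ltr01 (F := F))//.
- by apply: continuous_in_subspaceT => t /[!inE]/=; rewrite in_itv/=; exact: cf.
- split.
  + by move=> t; rewrite in_itv/= => /andP[/ltW t0 /ltW t1]; have [|] := dF t; rewrite ?t0.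
  + by apply: cvg_at_right_filter; apply: cF; rewrite lexx ler01.
  + by apply: cvg_at_left_filter; apply: cF; rewrite lexx ler01.
- move=> t; rewrite in_itv/= => /andP[/ltW t0 /ltW t1].
  by rewrite derive1E; have [|] := dF t; rewrite ?t0.
Qed.

Lemma cint_FTC (F f : R -> cplx R) : cpath f ->
  (forall t, 0 <= t <= 1 -> is_derive t 1 (fun s => Re (F s)) (Re (f t)) /\
                            is_derive t 1 (fun s => Im (F s)) (Im (f t))) ->
  cintegral01 f = F 1 - F 0.
Proof.
move=> cf dF; apply: cplx_eq; rewrite ?ReB ?ImB /=.
  by apply: (@Rint01_FTC (fun s => Re (F s))) => t t01; [exact: (cf t t01).1|exact: (dF t t01).1].
by apply: (@Rint01_FTC (fun s => Im (F s))) => t t01; [exact: (cf t t01).2|exact: (dF t t01).2].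
Qed.

End PathsAndIntegrals.

(** * Rules for complex derivatives *)

Section ComplexDerivatives.
Variable R : realType.
Implicit Types (x y z w a b c : cplx R) (f g : cplx R -> cplx R).

Lemma cder_cst c z : is_derive z 1 (fun=> c) 0.
Proof. exact: is_derive_cst. Qed.

Lemma cder_id z : is_derive z 1 (fun w : cplx R => w) 1.
Proof. exact: is_derive_id. Qed.

Lemma cderD f g z a b : is_derive z 1 f a -> is_derive z 1 g b ->
  is_derive z 1 (fun w => f w + g w) (a + b).
Proof. exact: is_deriveD. Qed.

Lemma cderB f g z a b : is_derive z 1 f a -> is_derive z 1 g b ->
  is_derive z 1 (fun w => f w - g w) (a - b).
Proof. exact: is_deriveB. Qed.

Lemma cderN f z a : is_derive z 1 f a -> is_derive z 1 (fun w => - f w) (- a).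
Proof. exact: is_deriveN. Qed.

Lemma cderM f g z a b : is_derive z 1 f a -> is_derive z 1 g b ->
  is_derive z 1 (fun w => f w * g w) (a * g z + f z * b).
Proof.
move=> fa gb; rewrite addrC [a * _]mulrC.
exact: (@is_deriveM _ _ f g z 1 a b).
Qed.

Lemma cderZ f c z a : is_derive z 1 f a -> is_derive z 1 (fun w => c * f w) (c * a).
Proof. exact: is_deriveZ. Qed.

Lemma cder_comp f g z a b : is_derive z 1 f a -> is_derive (f z) 1 g b ->
  is_derive z 1 (fun w => g (f w)) (b * a).
Proof.
move=> /is_derive_normc df /is_derive_normc dg; apply/is_derive_normc => e e0.
pose e1 := e / 2 / (normc a + 1); pose e2 := e / 2 / (normc b + 1).
have na := normc_ge0 a; have nb := normc_ge0 b.
have e10 : 0 < e1 by rewrite !divr_gt0// ltr_wpDl.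
have e20 : 0 < e2 by rewrite !divr_gt0// ltr_wpDl.
have [dg1 dg0 Hg] := dg _ e10.
have [d1 d10 H1] := df 1 ltr01; have [d2 d20 H2] := df _ e20.
exists (Num.min (dg1 / (normc a + 1)) (Num.min d1 d2)).
  by rewrite !lt_min d10 d20 divr_gt0// ltr_wpDl.
move=> w; rewrite !lt_min ltr_pdivlMr ?ltr_wpDl// => /and3P[wg w1 w2].
have fw : normc (f w - f z) <= normc (w - z) * (normc a + 1).
  rewrite -[f w - f z](subrK ((w - z) * a)); apply: le_trans (normcD _ _) _.
  by rewrite normcM addrC mulrDr mulr1 lerD2l -[leRHS]mul1r H1.
have -> : g (f w) - g (f z) - (w - z) * (b * a) =
    (g (f w) - g (f z) - (f w - f z) * b) + b * (f w - f z - (w - z) * a) by ring.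
apply: le_trans (normcD _ _) _; rewrite normcM.
have -> : e * normc (w - z) = e1 * (normc (w - z) * (normc a + 1)) +
    (normc b + 1) * (e2 * normc (w - z)).
  by rewrite /e1 /e2; field; rewrite !gt_eqF// ltr_wpDl.
apply: lerD.
  apply: le_trans (Hg _ (le_lt_trans fw wg)) _.
  by rewrite ler_wpM2l// ltW.
apply: ler_pM => //; rewrite ?normc_ge0 ?lerDl//.
exact: H2.
Qed.

Lemma cder_inv z : z != 0 -> is_derive z 1 (fun w : cplx R => w^-1) (- z ^- 2).
Proof.
move=> z0; have di : derivable (@id (cplx R)) z 1 by exact: derivable_id.
split; first exact: (@derivableV _ _ id).
by rewrite (@deriveV _ _ id)//= derive_id /GRing.scale/= mulr1 /GRing.exp/=.
Qed.

Lemma cder_exp f z a n : is_derive z 1 f a ->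
  is_derive z 1 (fun w => f w ^+ n) (n%:R * f z ^+ n.-1 * a).
Proof.
move=> fa; elim: n => [|n IH].
  by rewrite !mul0r; exact: cder_cst.
have := cderM fa IH.
have -> : (fun w => f w * f w ^+ n) = (fun w => f w ^+ n.+1).
  by apply/funext => w; rewrite exprS.
move=> H; apply: (is_derive_eq H); case: n {IH H} => [|n]; first by rewrite /=; ring.
by rewrite /= -[in RHS]natr1 exprS; ring.
Qed.

Lemma cder_sum (F : nat -> cplx R -> cplx R) (l : nat -> cplx R) z n :
  (forall i, (i < n)%N -> is_derive z 1 (F i) (l i)) ->
  is_derive z 1 (fun w => \sum_(0 <= i < n) F i w) (\sum_(0 <= i < n) l i).
Proof.
elim: n => [|n IH] H.
  rewrite big_geq//; have -> : (fun w => \sum_(0 <= i < 0) F i w) = (fun=> 0).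
    by apply/funext => w; rewrite big_geq.
  exact: cder_cst.
rewrite big_nat_recr//=.
have -> : (fun w => \sum_(0 <= i < n.+1) F i w) =
          (fun w => \sum_(0 <= i < n) F i w + F n w).
  by apply/funext => w; rewrite big_nat_recr.
by apply: cderD; [apply: IH => i /ltnW; exact: H|exact: H].
Qed.

Lemma cder_near f g z a : is_derive z 1 f a ->
  (exists2 d : R, 0 < d & forall w, normc (w - z) < d -> f w = g w) ->
  is_derive z 1 g a.
Proof.
by move=> fa fg; apply: near_eq_is_derive fa; apply/nbhs_normcP.
Qed.

Lemma cder_cts f z a : is_derive z 1 f a -> {for z, continuous f}.
Proof. by move=> [/derivable1_diffP/differentiable_continuous]. Qed.

End ComplexDerivatives.

(** * Averages along rays from the origin *)

Section RayIntegrals.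
Variable R : realType.
Implicit Types (x y z w a b c : cplx R) (f g : cplx R -> cplx R) (t : R).

(** The plane cut along [1, +oo[, in the form needed for integrals along the
    segment from 0 to z of functions with a singularity at 1. *)
Definition slit z := forall t, 0 <= t <= 1 -> 1 - t%:K * z != 0.

Lemma slit_star z s : slit z -> 0 <= s <= 1 -> slit (s%:K * z).
Proof.
move=> Dz /andP[s0 s1] t /andP[t0 t1]; rewrite mulrA -rmorphM; apply: Dz.
by rewrite mulr_ge0//= mulr_ile1.
Qed.

Lemma slit_line z : slit z -> forall t, 0 <= t <= 1 -> slit (0 + t%:K * z).
Proof. by move=> Dz t t01; rewrite add0r; exact: slit_star. Qed.

(** The continuous function |1 - t z| of t attains a positive minimum on
    [0, 1], and moving z moves it by at most the displacement. *)
Lemma slit_near z : slit z -> exists d m : R, [/\ 0 < d, 0 < m &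
  forall w, normc (w - z) < d -> forall t, 0 <= t <= 1 ->
    m <= normc (1 - t%:K * w)].
Proof.
move=> Dz; pose h t := normc (1 - t%:K * z).
have ch t : {for t, continuous h}.
  apply: continuous_real => e e0; have n0 : 0 < normc z + 1 by rewrite ltr_wpDl ?normc_ge0.
  exists (e / (normc z + 1)); first by rewrite divr_gt0.
  move=> s; rewrite ltr_pdivlMr// => st.
  have le x y : `|normc x - normc y| <= normc (x - y).
    have := normcD (y - x) x; have := normcD (x - y) y.
    rewrite !subrK (normcBC y x) ler_norml => h1 h2.
    by apply/andP; split; lra.
  apply: le_lt_trans (le _ _) _; apply: le_lt_trans st.
  have -> : 1 - s%:K * z - (1 - t%:K * z) = - ((s - t)%:K * z) by rewrite rmorphB; ring.
  by rewrite normcN normcM normcR ler_wpM2l// lerDl.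
have [c c01 hc] := EVT_min (@ler01 R)
  (@continuous_in_subspaceT _ _ _ h (fun t (_ : t \in (`[0, 1] : set R)) => ch t)).
rewrite in_itv/= in c01.
have m0 : 0 < h c by rewrite normc_gt0 Dz.
exists (h c / 2), (h c / 2); split; rewrite ?divr_gt0// => w wz t t01.
have := hc t; rewrite in_itv/= => /(_ t01) ht.
have := normcD (1 - t%:K * w) (t%:K * (w - z)).
have -> : 1 - t%:K * w + t%:K * (w - z) = 1 - t%:K * z by ring.
rewrite normcM normcR; have /andP[t0 t1] := t01; rewrite (ger0_norm t0).
have : t * normc (w - z) <= h c / 2.
  by rewrite (le_trans _ (ltW wz))// ler_piMl ?normc_ge0.
by rewrite -/(h t); lra.
Qed.

Lemma slit_open z : slit z -> exists2 d : R, 0 < d &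
  forall w, normc (w - z) < d -> slit w.
Proof.
move=> /slit_near[d [m [d0 m0 H]]]; exists d => // w wz t t01.
by rewrite -normc_gt0 (lt_le_trans m0)// H.
Qed.

(** A second-order Taylor estimate with one constant for all the points t z of a
    ray.  In this form it passes to averages along rays by integrating it over t,
    without differentiation under the integral sign. *)
Definition rayC2 g g' := forall z, slit z -> exists M d : R, 0 < d /\
  forall x y, normc (x - z) < d -> normc (y - z) < d -> forall t, 0 <= t <= 1 ->
    normc (g (t%:K * y) - g (t%:K * x) - t%:K * (y - x) * g' (t%:K * x))
      <= M * normc (y - x) ^+ 2.

Lemma rayC2_derive g g' z : rayC2 g g' -> slit z -> is_derive z 1 g (g' z).
Proof.
move=> H /H[M [d [d0 {}H]]]; apply: (@is_derive_sqr _ _ _ _ M d) => // w wz.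
have := H z w; rewrite subrr normc_0// => /(_ d0 wz 1).
by rewrite ler01 lexx !mul1r => /(_ isT).
Qed.

(** Adding the estimates from x to y and from y to x cancels the
    values of g and leaves a Lipschitz bound for its derivative. *)
Lemma rayC2_derive_cts g g' z : rayC2 g g' -> slit z -> {for z, continuous g'}.
Proof.
move=> H /H[M [d [d0 {}H]]]; apply/continuous_normcP => e e0.
pose M' := 2 * `|M| + 1; have M'0 : 0 < M' by rewrite ltr_wpDl// mulr_ge0.
exists (Num.min d (e / M')); first by rewrite lt_min d0 divr_gt0.
move=> w; rewrite lt_min => /andP[wd we].
have nz : normc (z - z) < d by rewrite subrr normc_0.
have [->|wz] := eqVneq w z; first by rewrite subrr normc_0.
have H1 := H z w nz wd 1; have H2 := H w z wd nz 1.
rewrite ler01 lexx !mul1r in H1 H2.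
have {H1 H2} := lerD (H1 isT) (H2 isT).
have n0 : 0 < normc (w - z) by rewrite normc_gt0 subr_eq0.
move=> /(le_trans (normcD _ _)).
have -> : g w - g z - (w - z) * g' z + (g z - g w - (z - w) * g' w) =
  (w - z) * (g' w - g' z) by ring.
rewrite [normc (z - w)]normcBC normcM.
have -> : M * normc (w - z) ^+ 2 + M * normc (w - z) ^+ 2 =
   normc (w - z) * (2 * M * normc (w - z)) by ring.
rewrite ler_pM2l// => /le_lt_trans; apply.
apply: le_lt_trans (_ : M' * normc (w - z) < _); last by rewrite mulrC -ltr_pdivlMr.
rewrite ler_wpM2r ?normc_ge0//; have := ler_norm M; rewrite /M'; lra.
Qed.

Lemma rayC2_path g g' z : rayC2 g g' -> slit z -> cpath (fun t => g (t%:K * z)).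
Proof.
move=> H Dz; have : cpath (fun t => g (0 + t%:K * z)).
  apply: cpath_line => t t01; apply: cder_cts (rayC2_derive H _).
  exact: slit_line.
by under [X in cpath X -> _]funext do rewrite add0r.
Qed.

Lemma rayC2_path' g g' z : rayC2 g g' -> slit z ->
  cpath (fun t => t%:K * g' (t%:K * z)).
Proof.
move=> H Dz t t01; have : cpath (fun t => g' (0 + t%:K * z)).
  apply: cpath_line => s s01; apply: rayC2_derive_cts H _.
  exact: slit_line.
under [X in cpath X -> _]funext do rewrite add0r.
move=> /(_ t t01)[c1 c2].
have ci : {for t, continuous (@id R)} by exact: cvg_id.
split.
  have -> : (fun s => Re (s%:K * g' (s%:K * z))) = (fun s => s * Re (g' (s%:K * z))).
    by apply/funext => s; rewrite ReZ.
  exact: continuousM.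
have -> : (fun s => Im (s%:K * g' (s%:K * z))) = (fun s => s * Im (g' (s%:K * z))).
  by apply/funext => s; rewrite ImZ.
exact: continuousM.
Qed.

Definition rayint g z := cintegral01 (fun t => g (t%:K * z)).
(** The derivative of [rayint g] in terms of that of g: the chain rule for
    g(t z) brings out the factor t. *)
Definition rayint' g' z := cintegral01 (fun t => t%:K * g' (t%:K * z)).

(** The estimate for g at t s, integrated over t, is the estimate for its
    average at s; the constant is doubled because the real and imaginary parts are
    bounded separately. *)
Lemma rayC2_rayint g g' : rayC2 g g' -> rayC2 (rayint g) (rayint' g').
Proof.
move=> H z Dz; have [M [d [d0 Hd]]] := H z Dz.
have [d1 d10 D1] := slit_open Dz.
exists (2 * M), (Num.min d d1); split; first by rewrite lt_min d0.
move=> x y; rewrite !lt_min => /andP[xd x1] /andP[yd y1] s s01.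
have Dx := slit_star (D1 _ x1) s01; have Dy := slit_star (D1 _ y1) s01.
have ix := cintegrable_path (rayC2_path H Dx).
have iy := cintegrable_path (rayC2_path H Dy).
have ix' := cintegrable_path (rayC2_path' H Dx).
rewrite /rayint /rayint' -cintB// -cintZ// -cintB//; last 2 first.
- exact: cintegrableB.
- exact: cintegrableZ.
rewrite -mulrA; apply: le_norm_cint.
  by apply: cintegrableB; [exact: cintegrableB|exact: cintegrableZ].
move=> t t01.
have := Hd x y xd yd (t * s).
have ts : 0 <= t * s <= 1.
  have /andP[t0 t1] := t01; have /andP[s0 s1] := s01.
  by rewrite mulr_ge0//= mulr_ile1.
move=> /(_ ts); rewrite rmorphM !mulrA.
by rewrite [s%:K * (y - x) * t%:K]mulrC !mulrA.
Qed.

(** The quotient Li_k(z) / z off the cut, see [polylog_ray].  Dividing by z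
    removes the singularity of Li_k(t z) / t at t = 0, and each quotient is the
    average of the preceding one along rays. *)
Fixpoint slope (k : nat) : cplx R -> cplx R :=
  if k is k'.+1 then rayint (slope k') else fun z => (1 - z)^-1.

Fixpoint slope' (k : nat) : cplx R -> cplx R :=
  if k is k'.+1 then rayint' (slope' k') else fun z => (1 - z) ^- 2.

Lemma slit1 z : slit z -> 1 - z != 0.
Proof. by move=> /(_ 1); rewrite ler01 lexx mul1r => /(_ isT). Qed.

(** For k = 0 the error term is t^2 (y - x)^2 / ((1 - t x)^2 (1 - t y)),
    where the denominators are bounded below by [slit_near]. *)
Lemma slope_rayC2 k : rayC2 (slope k) (slope' k).
Proof.
elim: k => [|k IH]; last exact: rayC2_rayint.
move=> z /slit_near[d [m [d0 m0 H]]]; exists (m ^- 3), d; split => // x y xd yd t t01.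
have mx := H _ xd t t01; have my := H _ yd t t01.
have x0 : 1 - t%:K * x != 0 by rewrite -normc_gt0 (lt_le_trans m0).
have y0 : 1 - t%:K * y != 0 by rewrite -normc_gt0 (lt_le_trans m0).
rewrite /=.
have -> : (1 - t%:K * y)^-1 - (1 - t%:K * x)^-1 - t%:K * (y - x) * (1 - t%:K * x) ^- 2
  = t%:K ^+ 2 * ((1 - t%:K * x) ^- 2 * (1 - t%:K * y)^-1) * (y - x) ^+ 2.
  by field; rewrite x0 y0.
rewrite normcM (normcX (y - x)) ler_wpM2r ?exprn_ge0 ?normc_ge0//.
rewrite normcM (normcX t%:K) normcM (normcV ((1 - t%:K * x) ^+ 2)).
rewrite (normcX (1 - t%:K * x)) (normcV (1 - t%:K * y)) normcR.
have /andP[t0 t1] := t01; rewrite (ger0_norm t0) -[leRHS]mul1r.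
apply: ler_pM; [by rewrite exprn_ge0| |exact: exprn_ile1|].
  by rewrite mulr_ge0 ?invr_ge0 ?exprn_ge0 ?normc_ge0.
rewrite -invfM lef_pV2 ?posrE ?mulr_gt0 ?exprn_gt0 ?(lt_le_trans m0)//.
rewrite exprSr; apply: ler_pM; rewrite ?exprn_ge0 ?(ltW m0)//.
by rewrite lerXn2r// ?nnegrE ?normc_ge0// (ltW m0).
Qed.

Lemma inv_sqr_path z : slit z -> cpath (fun t => (1 - t%:K * z) ^- 2).
Proof.
move=> Dz; pose q (w : cplx R) := (1 - w * z) ^- 2.
have -> : (fun t => (1 - t%:K * z) ^- 2) = (fun t => q (0 + t%:K * 1)).
  by apply/funext => t; rewrite add0r mulr1.
apply: cpath_line => t t01; rewrite add0r mulr1; have D0 := Dz t t01.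
have l : is_derive t%:K 1 (fun w => 1 - w * z) (0 - (1 * z + t%:K * 0)).
  exact: (cderB (cder_cst 1 _) (cderM (cder_id _) (cder_cst z _))).
by apply: cder_cts (cder_comp (cder_exp 2 l) (cder_inv _)); rewrite expf_neq0.
Qed.

Lemma cint_inv_sqr z : slit z -> cintegral01 (fun t => (1 - t%:K * z) ^- 2) = (1 - z)^-1.
Proof.
move=> Dz.
pose F (w : cplx R) := w * (1 - w * z)^-1.
have dF t : 0 <= t <= 1 -> is_derive (0 + t%:K * 1) 1 F ((1 - t%:K * z) ^- 2).
  move=> t01; rewrite add0r mulr1; have D0 := Dz t t01.
  have l : is_derive t%:K 1 (fun w => 1 - w * z) (0 - (1 * z + t%:K * 0)).
    exact: (cderB (cder_cst 1 _) (cderM (cder_id _) (cder_cst z _))).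
  have := cderM (cder_id t%:K) (cder_comp l (cder_inv D0)).
  by move=> /is_derive_eq; apply; field.
rewrite (cint_FTC (F := fun t => F (0 + t%:K * 1)) (inv_sqr_path Dz)).
  by rewrite /F !add0r !mulr1 !mul1r mul0r subr0.
by move=> t /dF /is_derive_line; rewrite mul1r.
Qed.

(** The derivative of z slope_(k+1)(z) is slope_k(z): this is
    z Li_(k+1)'(z) = Li_k(z) divided by z.  The first case integrates
    1 / (1 - t z)^2, and averaging along rays gives the following ones. *)
Lemma slope_ode k z : slit z -> slope k.+1 z + z * slope' k.+1 z = slope k z.
Proof.
elim: k z => [|k IH] z Dz.
  have H := slope_rayC2 0.
  have i1 := cintegrable_path (rayC2_path H Dz).
  have i2 := cintegrable_path (rayC2_path' H Dz).
  rewrite /= /rayint /rayint' -cintZ// -cintD//; last exact: cintegrableZ.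
  rewrite -cint_inv_sqr//; apply: (eq_cint (cintegrable_path (inv_sqr_path Dz)) _).2.
  move=> t /andP[/ltW t0 t1].
  have D0 : 1 - t%:K * z != 0 by apply: Dz; rewrite t0.
  by rewrite /=; field.
have H := slope_rayC2 k.+1.
have i1 := cintegrable_path (rayC2_path H Dz).
have i2 := cintegrable_path (rayC2_path' H Dz).
have Hk := slope_rayC2 k.
have i3 := cintegrable_path (rayC2_path Hk Dz).
rewrite [slope k.+2]/= [slope' k.+2]/= [in RHS]/= /rayint /rayint' -cintZ// -cintD//; last exact: cintegrableZ.
apply: (eq_cint i3 _).2 => t /andP[/ltW t0 t1].
rewrite -(IH (t%:K * z)); last by apply: slit_star; rewrite ?t0.
by rewrite mulrCA mulrA.
Qed.

End RayIntegrals.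

(** * Polylogarithms, logarithm and exponential off their cuts *)

Section LogAndExp.
Variable R : realType.
Implicit Types (x y z w a b c h : cplx R) (t : R).

Lemma ReV w : Re w^-1 = Re w / (Re w ^+ 2 + Im w ^+ 2).
Proof. by case: w. Qed.

Lemma ImV w : Im w^-1 = - (Im w / (Re w ^+ 2 + Im w ^+ 2)).
Proof. by case: w. Qed.

Lemma slit_ReIm z : Re z < 1 \/ Im z != 0 -> slit z.
Proof.
move=> H t /andP[t0 t1]; apply/eqP => E.
have rE : 1 - t * Re z = 0 by have := congr1 (@complex.Re R) E; rewrite ReB ReZ.
have iE : - (t * Im z) = 0.
  by have := congr1 (@complex.Im R) E; rewrite ImB ImZ /= sub0r.
case: H => [z1|z0].
  have [z0|z0] := leP 0 (Re z); last first.
    have : t * Re z <= 0 by rewrite mulr_ge0_le0// ltW.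
    by lra.
  have : t * Re z <= Re z by rewrite ler_piMl.
  by lra.
move/eqP: iE; rewrite oppr_eq0 mulf_eq0 (negPf z0) orbF => /eqP t00.
by move: rE; rewrite t00 mul0r subr0 => /eqP; rewrite oner_eq0.
Qed.

Lemma sin_atan (s : R) : sin (atan s) = s / Num.sqrt (1 + s ^+ 2).
Proof.
rewrite -cos_atan; have := atanK s; rewrite /tan => {2}<-.
rewrite divfK// cos_atan invr_eq0 gt_eqF// sqrtr_gt0.
by rewrite ltr_wpDr ?sqr_ge0.
Qed.

Lemma cexp_uniq x y : cexp x = cexp y -> `|Im x - Im y| < 2 * pi -> x = y.
Proof.
move=> e l; apply/eqP; rewrite -subr_eq0; apply/eqP; apply: cexp_eq1.
  by rewrite cexpD e -cexpD subrr cexp0.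
by rewrite ImB.
Qed.

Lemma cLog_cexp h : `|Im h| < pi -> cLog (cexp h) = h.
Proof.
move=> hl; apply: cexp_uniq; first by rewrite cLogK ?cexp_neq0.
have /andP[a1 a2] := cArg_itv (cexp_neq0 h).
rewrite [Im (cLog _)]/= ltr_norml; move: hl; rewrite ltr_norml => /andP[h1 h2].
by apply/andP; split; lra.
Qed.

Lemma ln_sqr_half (s : R) : 0 < s -> expR (2^-1 * ln s) = Num.sqrt s.
Proof.
move=> s0; have s1 : 0 < Num.sqrt s by rewrite sqrtr_gt0.
rewrite -[in ln _](sqr_sqrtr (ltW s0)) lnXn// -[ln _ *+ 2]mulr_natl mulrA mulVf// mul1r.
by rewrite lnK// posrE.
Qed.

(** Both sides are logarithms of 1 / (1 - z).  The left-hand side is the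
    integral of z / (1 - t z); its real part is elementary, and its imaginary part is
    a difference of two arctangents.  So the latter is less than pi in absolute
    value, which selects the principal branch. *)
Lemma ray_log z : slit z -> z * slope 1 z = - cLog (1 - z).
Proof.
move=> Dz; set x := Re z; set y := Im z.
pose q t := (1 - t * x) ^+ 2 + (t * y) ^+ 2.
have ReD t : Re (1 - t%:K * z) = 1 - t * x by rewrite ReB ReZ.
have ImD t : Im (1 - t%:K * z) = - (t * y) by rewrite ImB ImZ /= sub0r.
have qE t : q t = normc (1 - t%:K * z) ^+ 2.
  by rewrite sqr_normc_ReIm ReD ImD sqrrN.
have q0 t : 0 <= t <= 1 -> 0 < q t.
  by move=> /Dz D0; rewrite qE exprn_gt0// normc_gt0.
have q1 := q0 1; rewrite ler01 lexx in q1; have {}q1 := q1 isT.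
(* Values at t = 1 and, up to sign, at t = 0 of (t |z|^2 - x) / y, whose
   arctangent has derivative y / |1 - t z|^2. *)
pose A := (x ^+ 2 + y ^+ 2 - x) / y; pose B := x / y.
(* theta is minus the argument of 1 - z. *)
have [theta [zE tpi cE sE]] : exists theta : R,
    [/\ z * slope 1 z = (- (2^-1 * ln (q 1)) +i* theta)%C, `|theta| < pi,
     Num.sqrt (q 1) * cos theta = 1 - x & Num.sqrt (q 1) * sin theta = y].
  pose f t := z * (1 - t%:K * z)^-1.
  have fpath : cpath f.
    pose g w := z * (1 - w * z)^-1.
    have -> : f = (fun t => g (0 + t%:K * 1)).
      by apply/funext => t; rewrite add0r mulr1.
    apply: cpath_line => t t01; rewrite add0r mulr1.
    have l : is_derive t%:K 1 (fun w => 1 - w * z) (0 - (1 * z + t%:K * 0)).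
      exact: (cderB (cder_cst 1 _) (cderM (cder_id _) (cder_cst z _))).
    exact: cder_cts (cderZ z (cder_comp l (cder_inv (Dz t t01)))).
  have fi : z * slope 1 z = cintegral01 f.
    have pg := rayC2_path (slope_rayC2 0) Dz.
    by rewrite (cintZ z (cintegrable_path pg)).
  have Ref t : Re (f t) = (x - t * (x ^+ 2 + y ^+ 2)) / q t.
    rewrite ReM ReV ImV ReD ImD sqrrN -/(q t) -/x -/y; ring.
  have Imf t : Im (f t) = y / q t.
    rewrite ImM ReV ImV ReD ImD sqrrN -/(q t) -/x -/y; ring.
  pose L t := - (2^-1 * ln (q t)).
  have dq t : is_derive t 1 q (2 * (t * (x ^+ 2 + y ^+ 2) - x)).
    apply: is_derive_real => e e0.
    have n1 : 0 < x ^+ 2 + y ^+ 2 + 1 by rewrite ltr_wpDl ?addr_ge0 ?sqr_ge0.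
    exists (e / (x ^+ 2 + y ^+ 2 + 1)); first by rewrite divr_gt0.
    move=> s; rewrite ltr_pdivlMr// => st.
    have -> : q s - q t - (s - t) * (2 * (t * (x ^+ 2 + y ^+ 2) - x)) =
        (s - t) * ((s - t) * (x ^+ 2 + y ^+ 2)) by rewrite /q; ring.
    rewrite normrM mulrC ler_wpM2r// normrM; apply: le_trans (ltW st).
    by rewrite ler_wpM2l// ger0_norm ?lerDl ?addr_ge0 ?sqr_ge0.
  have dL t : 0 <= t <= 1 -> is_derive t 1 L (Re (f t)).
    move=> /q0 qt; rewrite Ref.
    have H := is_deriveN (is_deriveZ 2^-1 (is_derive1_comp (is_derive1_ln qt) (dq t))).
    apply: (is_derive_eq H); rewrite /GRing.scale/=.
    by field; rewrite gt_eqF.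
  have q_0 : q 0 = 1 by rewrite /q !mul0r subr0 expr1n expr0n addr0.
  have [y0|y0] := eqVneq y 0.
    have x1 : 0 < 1 - x.
      rewrite subr_gt0 ltNge; apply/negP => x1.
      have x0 : 0 < x by exact: lt_le_trans ltr01 x1.
      have := q0 x^-1; rewrite /q y0 mulr0 expr0n addr0 mulVf ?gt_eqF//.
      by rewrite subrr expr0n ltxx invr_ge0 (ltW x0) invf_le1// x1 => /(_ isT).
    exists 0; split.
    - rewrite fi (@cint_FTC _ (fun t => (L t +i* 0)%C) f fpath); last first.
        move=> t t01; split; first exact: dL.
        rewrite Imf y0 mul0r; exact: is_derive_cst.
      apply: cplx_eq; rewrite ?ReB ?ImB /= ?subr0//.
      by rewrite /L q_0 ln1 mulr0 oppr0 subr0.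
    - by rewrite normr0 pi_gt0.
    - by rewrite cos0 mulr1 /q y0 mulr0 expr0n addr0 mul1r sqrtr_sqr gtr0_norm.
    - by rewrite sin0 mulr0.
  pose P := Num.sqrt (1 + A ^+ 2); pose Q := Num.sqrt (1 + B ^+ 2).
  have P0 : 0 < P by rewrite sqrtr_gt0 ltr_wpDr ?sqr_ge0.
  have Q0 : 0 < Q by rewrite sqrtr_gt0 ltr_wpDr ?sqr_ge0.
  have S0 : 0 < Num.sqrt (q 1) by rewrite sqrtr_gt0.
  have N0 : 0 < x ^+ 2 + y ^+ 2 by rewrite ltr_wpDl ?sqr_ge0// exprn_even_gt0.
  have PQ : P * Q = Num.sqrt (q 1) * ((x ^+ 2 + y ^+ 2) / y ^+ 2).
    rewrite /P /Q -sqrtrM ?addr_ge0 ?sqr_ge0//.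
    have -> : (1 + A ^+ 2) * (1 + B ^+ 2) = q 1 * ((x ^+ 2 + y ^+ 2) / y ^+ 2) ^+ 2.
      by rewrite /A /B /q; field.
    rewrite sqrtrM ?(ltW q1)// sqrtr_sqr ger0_norm// divr_ge0 ?sqr_ge0//.
    exact: ltW.
  exists (atan A + atan B); split.
  - rewrite fi.
    rewrite (@cint_FTC _ (fun t => (L t +i* atan ((t * (x ^+ 2 + y ^+ 2) - x) / y))%C) f fpath); last first.
      move=> t t01; split; first exact: dL.
      have qt := q0 t t01.
      have dg : is_derive t 1 (fun s => (s * (x ^+ 2 + y ^+ 2) - x) / y)
                  ((x ^+ 2 + y ^+ 2) / y).
        apply: is_derive_real => e e0; exists 1 => // s _.
        have -> : (s * (x ^+ 2 + y ^+ 2) - x) / y - (t * (x ^+ 2 + y ^+ 2) - x) / y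
            - (s - t) * ((x ^+ 2 + y ^+ 2) / y) = 0 by field.
        by rewrite normr0 mulr_ge0// ltW.
      have H := @is_derive1_comp R (@atan R) (fun s => (s * (x ^+ 2 + y ^+ 2) - x) / y)
        t _ _ (is_derive1_atan _) dg.
      apply: (is_derive_eq H); rewrite Imf.
      have -> : 1 + ((t * (x ^+ 2 + y ^+ 2) - x) / y) ^+ 2 =
         (x ^+ 2 + y ^+ 2) * q t / y ^+ 2 by rewrite /q; field.
      by field; rewrite y0 !gt_eqF// ltr_wpDl ?sqr_ge0// exprn_even_gt0.
    apply: cplx_eq; rewrite ?ReB ?ImB /=.
      by rewrite /L q_0 ln1 mulr0 oppr0 subr0.
    by rewrite mul1r mul0r sub0r mulNr atanN opprK.
  - have := atan_gtNpi2 A; have := atan_ltpi2 A; have := atan_gtNpi2 B; have := atan_ltpi2 B.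
    move=> *; rewrite ltr_norml; apply/andP; split; lra.
  - rewrite cosD !cos_atan !sin_atan -/P -/Q.
    have -> : Num.sqrt (q 1) * (P^-1 * Q^-1 - A / P * (B / Q)) =
        Num.sqrt (q 1) * (1 - A * B) / (P * Q) by field; rewrite !gt_eqF.
    by rewrite PQ /A /B; field; rewrite y0 !gt_eqF.
  - rewrite sinD !cos_atan !sin_atan -/P -/Q.
    have -> : Num.sqrt (q 1) * (A / P * Q^-1 + P^-1 * (B / Q)) =
        Num.sqrt (q 1) * (A + B) / (P * Q) by field; rewrite !gt_eqF.
    by rewrite PQ /A /B; field; rewrite y0 !gt_eqF.
have K : cLog (1 - z) = (2^-1 * ln (q 1) +i* - theta)%C.
  apply: cexp_uniq.
    rewrite cLogK ?slit1//; apply: cplx_eq; rewrite /cexp /= ln_sqr_half// ?cosN ?sinN.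
      by rewrite cE ReB.
    by rewrite mulrN sE ImB /= sub0r.
  have /andP[a1 a2] := cArg_itv (slit1 Dz).
  rewrite /= ltr_norml; move: tpi; rewrite ltr_norml => /andP[h1 h2].
  by apply/andP; split; lra.
by rewrite K zE; apply: cplx_eq; rewrite /= ?opprK.
Qed.

Lemma polylog_ray k z : slit z -> polylog k z = z * slope k z.
Proof.
elim: k z => [//|[|k] IH] z Dz; first by rewrite ray_log.
have i := cintegrable_path (rayC2_path (slope_rayC2 k.+1) Dz).
rewrite -[LHS]/(cintegral01 (fun t => polylog k.+1 (t%:K * z) / t%:K)).
rewrite [slope k.+2]/= /rayint -cintZ//; apply: (eq_cint (cintegrableZ z i) _).2.
move=> t /andP[t0 t1]; rewrite IH; last by apply: slit_star; rewrite ?(ltW t0).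
rewrite [t%:K * z]mulrC mulrAC mulfK//.
by rewrite -normc_gt0 normcR normr_gt0 gt_eqF.
Qed.

Lemma polylog_derive k z : slit z -> is_derive z 1 (@polylog R k.+1) (slope k z).
Proof.
move=> Dz; have [d d0 H] := slit_open Dz.
apply: (cder_near (f := fun w => w * slope k.+1 w)); last first.
  by exists d => // w /H/polylog_ray.
have := cderM (cder_id z) (rayC2_derive (slope_rayC2 k.+1) Dz).
by rewrite mul1r slope_ode.
Qed.

(** Off its cut, Log w = - Li_1(1 - w). *)
Lemma cLog_derive w : 0 < Re w \/ Im w != 0 -> is_derive w 1 (@cLog R) w^-1.
Proof.
move=> Hw; have Dw : slit (1 - w).
  apply: slit_ReIm; rewrite ReB ImB /= sub0r oppr_eq0.
  by case: Hw => [?|->]; [left; lra|right].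
have l : is_derive w 1 (fun w => 1 - w) (0 - 1).
  exact: cderB (cder_cst 1 _) (cder_id _).
have := cderN (cder_comp l (polylog_derive 0 Dw)).
have -> : (fun w0 => - polylog 1 (1 - w0)) = @cLog R.
  by apply/funext => v /=; rewrite opprK subKr.
by move=> H; apply: (is_derive_eq H); rewrite /= subKr sub0r mulrN1 opprK.
Qed.

Lemma cLog1 : cLog (1 : cplx R) = 0.
Proof. by rewrite -[in LHS](@cexp0 R) cLog_cexp// normr0 pi_gt0. Qed.

(** By the functional equation it is enough to differentiate at 0.  There
    exp is a continuous local inverse of Log, whose derivative at 1 is 1. *)
Lemma cexp_derive z : is_derive z 1 (@cexp R) (cexp z).
Proof.
suff H0 : is_derive (0 : cplx R) 1 (@cexp R) 1.
  have l : is_derive z 1 (fun w => w - z) (1 - 0).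
    exact: cderB (cder_id _) (cder_cst z _).
  have H0' : is_derive (z - z) 1 (@cexp R) 1 by rewrite subrr.
  have := cderZ (cexp z) (cder_comp l H0').
  have -> : (fun w => cexp z * cexp (w - z)) = @cexp R.
    by apply/funext => w; rewrite -cexpD addrC subrK.
  by move=> H; apply: (is_derive_eq H); rewrite subr0 !mulr1.
have cts (e : R) : 0 < e -> exists2 d : R, 0 < d & forall h, normc h < d ->
    normc (cexp h - 1) < e.
  move=> e0; pose eta := Num.min 1 (e / 8).
  have eta0 : 0 < eta by rewrite lt_min ltr01 divr_gt0.
  have eta1 : eta <= 1 by rewrite ge_min lexx.
  have eta8 : eta <= e / 8 by rewrite ge_min lexx orbT.
  have C (f : R -> R) : {for 0, continuous f} -> exists2 d : R, 0 < d &
      forall t, `|t| < d -> `|f t - f 0| <= eta.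
    move=> /(@cvgrPdist_le _ _ _ (nbhs (0 : R)))/(_ eta eta0)/nbhs_ballP[d d0 H].
    by exists d => // t td; rewrite distrC; apply: H; rewrite /ball/= sub0r normrN.
  have [d1 d10 H1] := C _ (@continuous_expR R 0).
  have [d2 d20 H2] := C _ (@continuous_cos R 0).
  have [d3 d30 H3] := C _ (@continuous_sin R 0).
  exists (Num.min d1 (Num.min d2 d3)); first by rewrite !lt_min d10 d20 d30.
  move=> h; rewrite !lt_min => /and3P[l1 l2 l3].
  have := H1 _ (le_lt_trans (normRe_le _) l1); rewrite expR0 => E1.
  have := H2 _ (le_lt_trans (normIm_le _) l2); rewrite cos0 => E2.
  have := H3 _ (le_lt_trans (normIm_le _) l3); rewrite sin0 subr0 => E3.
  apply: le_lt_trans (normc_leD _) _; rewrite ReB ImB /= subr0.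
  set u := expR (Re h) in E1 *; set cc := cos (Im h) in E2 *.
  set ss := sin (Im h) in E3 *.
  have -> : u * cc - 1 = (u - 1) * (cc - 1) + (u - 1) + (cc - 1) by ring.
  have -> : u * ss = (u - 1) * ss + ss by ring.
  have M (p q : R) : `|p| <= eta -> `|q| <= eta -> `|p * q| <= eta.
    move=> pe qe; rewrite normrM -[leRHS]mulr1.
    by apply: ler_pM => //; exact: le_trans qe eta1.
  have := ler_normD ((u - 1) * (cc - 1) + (u - 1)) (cc - 1).
  have := ler_normD ((u - 1) * (cc - 1)) (u - 1).
  have := ler_normD ((u - 1) * ss) ss.
  have := M _ _ E1 E2; have := M _ _ E1 E3.
  by lra.
apply/is_derive_normc => e e0.
have := @cLog_derive 1; rewrite /= ltr01 invr1 => /(_ (or_introl isT)) /is_derive_normc dl.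
pose e1 := Num.min (e / 2) (2^-1).
have e10 : 0 < e1 by rewrite lt_min !divr_gt0//= invr_gt0.
have [d d0 H] := dl _ e10; have [d' d'0 H'] := cts _ d0.
exists (Num.min d' pi); first by rewrite lt_min d'0 pi_gt0.
move=> h; rewrite subr0 lt_min => /andP[hd hpi].
have := H (cexp h) (H' _ hd).
rewrite cLog1 subr0 mulr1 cLog_cexp; last exact: le_lt_trans (normIm_le _) hpi.
rewrite cexp0 mulr1 => K.
have nh := normc_ge0 h; have np := normc_ge0 (cexp h - 1).
have K1 : normc (cexp h - 1) <= 2 * normc h.
  have := normcB h (h - (cexp h - 1)); rewrite subKr => K2.
  have : e1 * normc (cexp h - 1) <= 2^-1 * normc (cexp h - 1).
    by rewrite ler_wpM2r// ge_min lexx orbT.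
  lra.
rewrite normcBC; apply: le_trans K _.
have : e1 * normc (cexp h - 1) <= e / 2 * normc (cexp h - 1).
  by rewrite ler_wpM2r// ge_min lexx.
move=> /le_trans; apply; rewrite -mulrA ler_wpM2l ?(ltW e0)//; lra.
Qed.

End LogAndExp.

(** * An integrable majorant at the branch point *)

Section RootMajorant.
Variable R : realType.
Implicit Types (x y z w a b c h : cplx R) (t : R).
Local Notation mu := (@lebesgue_measure R).

(** For w != 0 this is |w|^(-1/2), which dominates the logarithmic singularity
    of Li_1 at 1 and is integrable along the real axis. *)
Definition rsqrt w := expR (- 4^-1 * ln (normc w ^+ 2)).

Lemma rsqrt_ge0 w : 0 <= rsqrt w. Proof. exact: expR_ge0. Qed.

Lemma rsqrt4 w : w != 0 -> rsqrt w ^+ 4 = (normc w ^+ 2)^-1.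
Proof.
move=> w0; have q0 : 0 < normc w ^+ 2 by rewrite exprn_gt0// normc_gt0.
rewrite /rsqrt -expRM_natl -[RHS](lnK (_ : _ \is Num.pos)) ?posrE ?invr_gt0//.
by rewrite lnV ?posrE//; congr expR; field.
Qed.

Lemma ln_le_rsqrt w : - ln (normc w ^+ 2) <= 4 * rsqrt w.
Proof.
have := expR_ge1Dx (- 4^-1 * ln (normc w ^+ 2)); rewrite -/(rsqrt w).
by have := rsqrt_ge0 w; lra.
Qed.

Lemma rsqrt_le2 w : 1 / 2 <= normc w -> rsqrt w <= 2.
Proof.
move=> w2; have w0 : w != 0 by rewrite -normc_gt0 (lt_le_trans _ w2)// divr_gt0.
rewrite -(@ler_pXn2r _ 4)// ?nnegrE ?rsqrt_ge0// rsqrt4//.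
rewrite -[leRHS]invrK lef_pV2 ?posrE ?invr_gt0 ?exprn_gt0 ?normc_gt0//.
have : (1 / 2) ^+ 2 <= normc w ^+ 2 by rewrite lerXn2r ?nnegrE ?divr_ge0 ?normc_ge0.
by apply: le_trans; lra.
Qed.

Lemma normc_1B_sqr z t : normc (1 - t%:K * z) ^+ 2 =
  1 - 2 * t * Re z + t ^+ 2 * normc z ^+ 2.
Proof.
by rewrite !sqr_normc_ReIm ReB ImB ReZ ImZ /=; ring.
Qed.

Lemma is_derive_1B_sqr z t :
  is_derive t 1 (fun s => normc (1 - s%:K * z) ^+ 2) (2 * (t * normc z ^+ 2 - Re z)).
Proof.
apply: is_derive_real => e e0.
have n1 : 0 < normc z ^+ 2 + 1 by rewrite ltr_wpDl ?sqr_ge0.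
exists (e / (normc z ^+ 2 + 1)); first by rewrite divr_gt0.
move=> s; rewrite ltr_pdivlMr// => st; rewrite !normc_1B_sqr.
set N := normc z ^+ 2 in st n1 *; set r := Re z.
have N0 : 0 <= N by rewrite sqr_ge0.
have -> : 1 - 2 * s * r + s ^+ 2 * N - (1 - 2 * t * r + t ^+ 2 * N) -
    (s - t) * (2 * (t * N - r)) = (s - t) * ((s - t) * N) by ring.
rewrite normrM mulrC ler_wpM2r// normrM; apply: le_trans (ltW st).
by rewrite ler_wpM2l// ger0_norm ?lerDl.
Qed.

Lemma is_derive_rsqrt z t : 1 - t%:K * z != 0 ->
  is_derive t 1 (fun s => rsqrt (1 - s%:K * z))
    (rsqrt (1 - t%:K * z) * (- 4^-1 * (2 * (t * normc z ^+ 2 - Re z) / normc (1 - t%:K * z) ^+ 2))).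
Proof.
move=> D0; have q0 : 0 < normc (1 - t%:K * z) ^+ 2 by rewrite exprn_gt0// normc_gt0.
have H1 := @is_derive1_comp R (@ln R) (fun s => normc (1 - s%:K * z) ^+ 2) t _ _
  (is_derive1_ln q0) (is_derive_1B_sqr z t).
have H2 := is_deriveZ (- 4^-1) H1.
have H3 := @is_derive1_comp R (@expR R) _ t _ _ (is_derive_expR _) H2.
by apply: (is_derive_eq H3); rewrite /GRing.scale/= [in RHS](mulrC (2 * _)).
Qed.

Lemma rsqrt_path z : slit z -> forall t, 0 <= t <= 1 ->
  {for t, continuous (fun s : R => rsqrt (1 - s%:K * z))}.
Proof.
by move=> Dz t /Dz/is_derive_rsqrt[/derivable1_diffP/differentiable_continuous].
Qed.

Lemma rsqrt_integrable z : slit z ->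
  mu.-integrable `[0, 1] (EFin \o (fun t => rsqrt (1 - t%:K * z))).
Proof.
move=> Dz; apply: continuous_compact_integrable; first exact: segment_compact.
apply: continuous_in_subspaceT => t /[!inE]/=; rewrite in_itv/=.
exact: rsqrt_path.
Qed.

(** Completing the square, |1 - t z|^2 = s^2 + e with s affine in t of
    slope |z| and e >= 0 constant.  The primitive used is s (s^2 + e)^(-1/4): it is
    bounded in terms of |z| alone, and its derivative is at least
    |z| / 2 (s^2 + e)^(-1/4).  Hence a bound that does not deteriorate as z approaches
    the cut. *)
Lemma rsqrt_int_le_far z : slit z -> 4^-1 <= normc z ->
  \int[mu]_(t in `[0, 1]) rsqrt (1 - t%:K * z) <= 18.
Proof.
move=> Dz z4; have z0 : 0 < normc z by exact: lt_le_trans z4.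
(* H is a primitive of h, and 2 h / |z| dominates the integrand. *)
pose s t : R := t * normc z - Re z / normc z.
pose q t : R := normc (1 - t%:K * z) ^+ 2.
have q0 t : 0 <= t <= 1 -> 0 < q t by move=> /Dz D0; rewrite exprn_gt0// normc_gt0.
have sq t : s t ^+ 2 <= q t.
  rewrite /q normc_1B_sqr /s.
  have -> : 1 - 2 * t * Re z + t ^+ 2 * normc z ^+ 2 =
     (t * normc z - Re z / normc z) ^+ 2 + (1 - (Re z / normc z) ^+ 2).
    by field; rewrite gt_eqF.
  rewrite lerDl subr_ge0 expr_div_n ler_pdivrMr ?exprn_gt0// mul1r.
  by rewrite sqr_normc_ReIm lerDl sqr_ge0.
pose H t := s t * rsqrt (1 - t%:K * z).
pose h t : R := normc z * rsqrt (1 - t%:K * z) * (1 - s t ^+ 2 / (2 * q t)).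
have ds t : is_derive t 1 s (normc z).
  apply: is_derive_real => e e0; exists 1 => // r _.
  have -> : s r - s t - (r - t) * normc z = 0 by rewrite /s; ring.
  by rewrite normr0 mulr_ge0// ltW.
have dH t : 0 <= t <= 1 -> is_derive t 1 H (h t).
  move=> t01; have qt := q0 t t01.
  have Hd := is_deriveM (ds t) (is_derive_rsqrt (Dz t t01)).
  apply: (is_derive_eq Hd); rewrite /GRing.scale/= /h -/(q t).
  have -> : 2 * (t * normc z ^+ 2 - Re z) = 2 * normc z * s t.
    by rewrite /s; field; rewrite gt_eqF.
  by field; rewrite gt_eqF.
have ch t : 0 <= t <= 1 -> {for t, continuous h}.
  move=> t01; have cs : {for t, continuous s}.
    by have [/derivable1_diffP/differentiable_continuous] := ds t.
  have cq : {for t, continuous q}.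
    by have [/derivable1_diffP/differentiable_continuous] := is_derive_1B_sqr z t.
  have cc (c : R) : {for t, continuous (fun=> c)} by exact: cst_continuous.
  have qt : 2 * q t != 0 by rewrite mulf_neq0// gt_eqF// q0.
  have c1 : {for t, continuous (fun r => 2 * q r)} by exact: (continuousM (cc 2) cq).
  have c2 : {for t, continuous (fun r => (2 * q r)^-1)}.
    by move: (@continuousV R R (fun r => 2 * q r) t qt c1).
  have c3 : {for t, continuous (fun r => s r ^+ 2)} by exact: (continuousM cs cs).
  have c4 : {for t, continuous (fun r => s r ^+ 2 / (2 * q r))}.
    exact: (continuousM c3 c2).
  have c5 : {for t, continuous (fun r => 1 - s r ^+ 2 / (2 * q r))}.
    exact: (continuousB (cc 1) c4).
  exact: (continuousM (continuousM (cc _) (rsqrt_path Dz t01)) c5).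
have hge t : 0 <= t <= 1 -> rsqrt (1 - t%:K * z) <= 2 / normc z * h t.
  move=> t01; have qt := q0 t t01; have st := sq t.
  rewrite /h; set p := s t ^+ 2 / _; set r := rsqrt _.
  have p2 : 2 * p <= 1.
    have -> : 2 * p = s t ^+ 2 / q t by rewrite /p; field; rewrite gt_eqF.
    by rewrite ler_pdivrMr// mul1r.
  have -> : 2 / normc z * (normc z * r * (1 - p)) = 2 * (r * (1 - p)).
    by field; rewrite gt_eqF.
  have : 0 <= r * (1 - 2 * p) by rewrite mulr_ge0 ?rsqrt_ge0// subr_ge0.
  by lra.
have ih : mu.-integrable `[0, 1] (EFin \o h).
  apply: continuous_compact_integrable; first exact: segment_compact.
  by apply: continuous_in_subspaceT => t /[!inE]/=; rewrite in_itv/=; exact: ch.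
have ih2 : mu.-integrable `[0, 1] (EFin \o (fun t => 2 / normc z * h t)).
  have := integrableZl (@measurable01 R) (2 / normc z) ih.
  by apply: eq_integrable => // t _; rewrite /= EFinM.
have := le_Rintegral (@measurable01 R) (rsqrt_integrable Dz) ih2.
move=> /(_ _)/le_trans; apply.
  by move=> t /=; rewrite in_itv/=; exact: hge.
rewrite RintegralZl// (Rint01_FTC ch dH).
have H0 : - H 0 <= 1.
  rewrite /H /s !mul0r sub0r subr0 /rsqrt.
  rewrite normc_1 expr1n ln1 mulr0 expR0 mulr1 opprK ler_pdivrMr// mul1r.
  exact: le_trans (ler_norm _) (normRe_le _).
have H1 : H 1 <= 1 + normc z.
  have z10 : 1 - z != 0 := slit1 Dz.
  have [Hn|Hp] := leP (H 1) 0; first by apply: le_trans Hn _; rewrite addr_ge0// ltW.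
  have q1 : 0 < normc (1 - z) ^+ 2 by rewrite exprn_gt0// normc_gt0.
  have le1 : normc (1 - z) ^+ 2 <= (1 + normc z) ^+ 2.
    rewrite lerXn2r ?nnegrE ?normc_ge0 ?addr_ge0 ?normc_ge0//.
    by apply: le_trans (normcB _ _) _; rewrite normc_1.
  rewrite -(@ler_pXn2r _ 4)// ?nnegrE ?(ltW Hp) ?addr_ge0 ?normc_ge0//.
  rewrite /H exprMn mul1r rsqrt4// ler_pdivrMr//.
  have := sq 1; rewrite /q mul1r => s1.
  have -> : s 1 ^+ 4 = s 1 ^+ 2 * s 1 ^+ 2 by ring.
  apply: ler_pM; rewrite ?sqr_ge0//; apply: (le_trans s1).
  apply: (le_trans le1); rewrite ler_weXn2l// lerDl; exact: normc_ge0.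
rewrite mulrAC ler_pdivrMr//; lra.
Qed.

End RootMajorant.

(** * Approaching the real axis from below *)

Section BoundaryValues.
Variable R : realType.
Implicit Types (x y z w a b c h : cplx R) (t : R).
Local Notation mu := (@lebesgue_measure R).

Lemma cvg_normcP (u : nat -> cplx R) (l : cplx R) : (u @ \oo --> l) <->
  forall e : R, 0 < e -> \forall n \near \oo, normc (u n - l) < e.
Proof.
split=> [/cvgrPdist_lt H e e0|H].
  have := H e%:K; rewrite ltcR => /(_ e0); apply: filterS => n.
  by rewrite cplx_norm ltcR normcBC.
apply/cvgrPdist_lt => e e0.
have eE : e = (Re e)%:K.
  by apply: cplx_eq => //=; move: e0; rewrite ltcE => /andP[/eqP].
rewrite eE ltcR in e0; have := H _ e0; apply: filterS => n.
by rewrite cplx_norm eE ltcR normcBC.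
Qed.

Lemma cvg_ReIm (u : nat -> cplx R) (l : cplx R) : (u @ \oo --> l) <->
  ((fun n => Re (u n)) @ \oo --> Re l) /\ ((fun n => Im (u n)) @ \oo --> Im l).
Proof.
split=> [/cvg_normcP H|[/cvgrPdist_lt H1 /cvgrPdist_lt H2]].
  split; apply/cvgrPdist_lt => e e0; have := H e e0; apply: filterS => n;
    apply: le_lt_trans; rewrite distrC.
    by rewrite -ReB normRe_le.
  by rewrite -ImB normIm_le.
apply/cvg_normcP => e e0; have e2 : 0 < e / 2 by rewrite divr_gt0.
near=> n; apply: le_lt_trans (normc_leD _) _; rewrite ReB ImB (splitr e).
rewrite distrC [X in _ + X]distrC; apply: ltrD; near: n; [exact: H1|exact: H2].
Unshelve. all: by end_near. Qed.

Lemma seq_cvgD (u v : nat -> cplx R) (a b : cplx R) :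
  u @ \oo --> a -> v @ \oo --> b -> (fun n => u n + v n) @ \oo --> a + b.
Proof. by move=> ua vb; have H := cvgD ua vb; apply: H. Qed.

Lemma seq_cvgN (u : nat -> cplx R) (a : cplx R) :
  u @ \oo --> a -> (fun n => - u n) @ \oo --> - a.
Proof. by move=> ua; have H := cvgN ua; apply: H. Qed.

Lemma seq_cvgB (u v : nat -> cplx R) (a b : cplx R) :
  u @ \oo --> a -> v @ \oo --> b -> (fun n => u n - v n) @ \oo --> a - b.
Proof. by move=> ua /seq_cvgN; exact: seq_cvgD. Qed.

Lemma seq_cvg_cst (a : cplx R) : (fun=> a) @ \oo --> a.
Proof. exact: cvg_cst. Qed.

(** The limit is measurable although convergence may fail at a: changing
    the values of the sequence at a into f a gives convergence everywhere. *)
Lemma Rint01_dct (f_ : nat -> R -> R) (f : R -> R) (g : R -> \bar R) (a : R) :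
  (forall n, mu.-integrable `[0, 1] (EFin \o f_ n)) ->
  (forall t, 0 <= t <= 1 -> t != a -> f_ ^~ t @ \oo --> f t) ->
  mu.-integrable `[0, 1] g ->
  (forall n t, 0 <= t <= 1 -> (`|f_ n t|%:E <= g t)%E) ->
  mu.-integrable `[0, 1] (EFin \o f) /\
  (fun n => \int[mu]_(t in `[0, 1]) f_ n t) @ \oo --> \int[mu]_(t in `[0, 1]) f t.
Proof.
move=> fi ff gi fg.
have mf_ n := measurable_int mu (fi n).
have I01 t : `[0, 1]%classic t -> 0 <= t <= 1 by rewrite /= in_itv.
have [|||||i1 _ i2] := @dominated_convergence _ _ _ mu `[0, 1]%classic
   (@measurable01 R) (fun n => EFin \o f_ n) (EFin \o f) g.
- exact: mf_.
- apply/measurable_EFinP.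
  (* The sequence is modified at a only. *)
  apply: (@measurable_fun_cvg _ _ _ _ (fun n t => f_ n t + (f a - f_ n a) * \1_[set a] t)).
    move=> n; apply: measurable_funD; first by have mn := mf_ n; apply/measurable_EFinP.
    by apply: measurable_funM => //; exact: measurable_indic.
  move=> t /I01 t01; rewrite indicE; have [->|ta] := eqVneq t a.
    rewrite mem_set//; under eq_cvg do rewrite mulr1 addrC subrK.
    exact: cvg_cst.
  rewrite memNset; last by move=> /= ta'; rewrite ta' eqxx in ta.
  by under eq_cvg do rewrite mulr0 addr0; exact: ff.
- exists [set a]; split; [exact: measurable_set1|exact: lebesgue_measure_set1|].
  move=> t /=; apply: contra_notP => /eqP ta /I01 t01.
  by apply/fine_cvgP; split; [exact: nearW|exact: ff].
- exact: gi.
- by apply: aeW => t n /I01 t01; exact: fg.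
split => //; apply: fine_cvg; rewrite /Rintegral fineK//.
exact: integrable_fin_num.
Qed.

(** The real axis is approached from below through the points
    x (1 - i / (n + 1)), because replacing x by t x then amounts to moving along a ray
    from 0. *)
Definition lowdir (n : nat) : cplx R := (1 +i* - n.+1%:R^-1)%C.

Lemma normc_lowdir_le2 n : normc (lowdir n) <= 2.
Proof.
apply: le_trans (normc_leD _) _ => /=; rewrite normr1 normrN ger0_norm//.
by rewrite -[leRHS]/(1 + 1 : R) lerD2l invf_le1 ?ler1n ?ltr0n.
Qed.

Lemma slit_lowdir (x : R) n : 0 <= x -> slit (x%:K * lowdir n).
Proof.
rewrite le_eqVlt => /predU1P[<-|x0]; apply: slit_ReIm.
  by left; rewrite ReZ mul0r.
right; rewrite ImZ /= mulrN oppr_eq0 mulf_neq0// gt_eqF// invr_gt0//.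
Qed.

Lemma cvg_lowdir (x : R) : (fun n => x%:K * lowdir n) @ \oo --> x%:K.
Proof.
apply/cvg_ReIm; split.
  under eq_cvg do rewrite ReZ /= mulr1.
  exact: cvg_cst.
under eq_cvg do rewrite ImZ /= mulrN.
suff : (fun n => - (x * n.+1%:R^-1)) @ \oo --> - (x * 0) by rewrite mulr0 oppr0.
by apply: cvgN; apply: cvgMr; exact: cvg_harmonic.
Qed.

Lemma normc_1Blowdir_nonincr (x : R) m n : (m <= n)%N ->
  normc (1 - x%:K * lowdir n) <= normc (1 - x%:K * lowdir m).
Proof.
move=> mn; rewrite -(@ler_pXn2r _ 2)// ?nnegrE ?normc_ge0//.
(* Only the imaginary part - x / (n + 1) depends on n. *)
rewrite !sqr_normc_ReIm !ReB !ImB !ReZ !ImZ /= lerD2l !sub0r !sqrrN !exprMn.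
rewrite ler_wpM2l ?sqr_ge0// !sqrrN lerXn2r ?nnegrE ?invr_ge0//.
by rewrite lef_pV2 ?posrE// ler_nat.
Qed.

(** The factor x is there to compensate the division by t in the next
    polylogarithm.  For x <= 1/4 it comes from the ray integral; for x >= 1/4 any
    constant is O(x). *)
Lemma polylog1_le (x : R) n : 0 <= x ->
  normc (polylog 1 (x%:K * lowdir n)) <= x * (20 + 16 * rsqrt (1 - x%:K * lowdir n)).
Proof.
move=> x0; have Dz := slit_lowdir n x0; set z := x%:K * lowdir n in Dz *.
have zx : normc z <= 2 * x.
  by rewrite normcM normcR ger0_norm// mulrC ler_wpM2r// normc_lowdir_le2.
have rs := rsqrt_ge0 (1 - z).
have [x4|x4] := leP x 4^-1.
  rewrite polylog_ray// normcM.
  have g4 : normc (slope 1 z) <= 2 * 2.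
    apply: le_norm_cint; first exact: cintegrable_path (rayC2_path (slope_rayC2 0) Dz).
    move=> t t01; rewrite normcV -[leRHS]invrK lef_pV2 ?posrE ?normc_gt0 ?Dz//.
    have := normcD (1 - t%:K * z) (t%:K * z); rewrite subrK.
    rewrite normc_1 normcM normcR.
    have /andP[t0 t1] := t01; rewrite (ger0_norm t0).
    have : t * normc z <= 1 * (2 * 4^-1).
      apply: ler_pM => //; first exact: normc_ge0.
      by apply: le_trans zx _; rewrite ler_wpM2l.
    by lra.
  have : normc z * normc (slope 1 z) <= 2 * x * (2 * 2).
    by apply: ler_pM; rewrite ?normc_ge0.
  have : 0 <= x * rsqrt (1 - z) by rewrite mulr_ge0.
  by lra.
have z1 := slit1 Dz.
have N0 : 0 < normc (1 - z) by rewrite normc_gt0.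
rewrite [polylog 1 z]/= normcN; apply: le_trans (normc_leD _) _.
have A : `|Im (cLog (1 - z))| <= 16 * x.
  have /andP[a1 a2] := cArg_itv z1; rewrite [Im _]/=.
  have : pi <= 4 :> R by have := @pihalf_lt2 R; lra.
  by rewrite ler_norml => p4; apply/andP; split; lra.
have B : `|Re (cLog (1 - z))| <= 2 * x + 8 * x * rsqrt (1 - z).
  rewrite [Re _]/=; have L := ln_le_rsqrt (1 - z); rewrite lnXn// in L.
  have U : ln (normc (1 - z)) <= 2 * x.
    have := @le_ln1Dx R (normc (1 - z) - 1); have -> : 1 + (normc (1 - z) - 1) = normc (1 - z) by ring.
    rewrite ltrBrDl subrr.
    move=> /(_ N0)/le_trans; apply; have := normcB 1 z.
    by rewrite normc_1; lra.
  have : 4^-1 * rsqrt (1 - z) <= x * rsqrt (1 - z) by rewrite ler_wpM2r// ltW.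
  rewrite ler_norml => h; apply/andP; split; last by lra.
  by rewrite mulr2n in L; lra.
have : 0 <= x * rsqrt (1 - z) by rewrite mulr_ge0.
by lra.
Qed.

End BoundaryValues.

(** * The cut carries the limits from below *)

Section BoundaryLimits.
Variable R : realType.
Implicit Types (x y z w a b c h : cplx R) (t : R).
Local Notation mu := (@lebesgue_measure R).
Local Notation lowdir := (@lowdir R).

Lemma rsqrt_int_le z : slit z ->
  \int[mu]_(t in `[0, 1]) rsqrt (1 - t%:K * z) <= 18.
Proof.
move=> Dz; have [/(rsqrt_int_le_far Dz)//|z4] := leP (4^-1) (normc z).
apply: (@le_trans _ _ 2); last by rewrite ler_nat.
rewrite -[leRHS]Rint01_cst.
apply: (le_Rintegral (@measurable01 R) (rsqrt_integrable Dz) (integrable01_cst 2)).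
move=> t /=; rewrite in_itv/= => /andP[t0 t1]; apply: rsqrt_le2.
have := normcD (1 - t%:K * z) (t%:K * z); rewrite subrK.
rewrite normc_1 normcM normcR (ger0_norm t0).
have : t * normc z <= 1 * 4^-1 by apply: ler_pM => //; [exact: normc_ge0|exact: ltW].
by lra.
Qed.

(** The functions increase with n, so their limit is a majorant,
    infinite at t = 1 / x, and monotone convergence bounds its integral. *)
Lemma rsqrt_lowdir_majorant (x : R) : 0 <= x -> exists g : R -> \bar R,
  mu.-integrable `[0, 1] g /\
  forall n t, 0 <= t <= 1 -> ((rsqrt (1 - t%:K * (x%:K * lowdir n)))%:E <= g t)%E.
Proof.
move=> x0; pose u n t := (rsqrt (1 - t%:K * (x%:K * lowdir n)))%:E.
have I01 t : `[0, 1]%classic t -> 0 <= t <= 1 by rewrite /= in_itv.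
have mono t : 0 <= t <= 1 -> nondecreasing_seq (u ^~ t).
  move=> t01 m n mn; have Dn := slit_lowdir n x0 t01; have Dm := slit_lowdir m x0 t01.
  rewrite lee_fin ler_expR !mulNr lerN2 ler_wpM2l ?invr_ge0//.
  rewrite ler_ln ?posrE ?exprn_gt0 ?normc_gt0//.
  rewrite lerXn2r ?nnegrE ?normc_ge0// !mulrA -!rmorphM.
  exact: normc_1Blowdir_nonincr.
pose g t := limn (u ^~ t).
have mu_ n := measurable_int mu (rsqrt_integrable (slit_lowdir n x0)).
exists g; split; last first.
  move=> n t t01; apply: lime_ge; first exact: ereal_nondecreasing_is_cvgn (mono t t01).
  by near=> m; apply: (mono t t01); near: m; exists n.
have u0 n t : `[0, 1]%classic t -> (0 <= u n t)%E by move=> _; rewrite lee_fin rsqrt_ge0.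
have E := @monotone_convergence _ _ _ mu _ (@measurable01 R) u mu_ u0
  (fun t Dt => mono t (I01 t Dt)).
apply/integrableP; split.
  apply: (@emeasurable_fun_cvg _ _ _ _ u g mu_) => t /I01 t01.
  exact: ereal_nondecreasing_is_cvgn (mono t t01).
apply: (@le_lt_trans _ _ 18%:E); last exact: ltry.
have -> : (\int[mu]_(t in `[0%R, 1%R]) `|g t| = \int[mu]_(t in `[0%R, 1%R]) g t)%E.
  apply: eq_integral => t /[!inE] /I01 t01; rewrite gee0_abs//; apply: lime_ge.
    exact: ereal_nondecreasing_is_cvgn (mono t t01).
  by apply: nearW => n; rewrite lee_fin rsqrt_ge0.
rewrite E; apply: lime_le.
  apply: ereal_nondecreasing_is_cvgn => m n mn; apply: ge0_le_integral => //.
  - exact: u0.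
  - exact: mu_.
  - exact: mu_.
  - by move=> t /I01 t01; exact: mono.
apply: nearW => n; have := rsqrt_int_le (slit_lowdir n x0).
rewrite -lee_fin /Rintegral fineK//.
exact: integrable_fin_num (rsqrt_integrable (slit_lowdir n x0)).
Unshelve. all: by end_near. Qed.

Lemma polylog_ray_integrable k z : slit z ->
  cintegrable (fun t => polylog k (t%:K * z) / t%:K).
Proof.
move=> Dz; have i := cintegrable_path (rayC2_path (slope_rayC2 k) Dz).
apply: (eq_cint (cintegrableZ z i) _).1.
move=> t /andP[t0 t1]; rewrite polylog_ray; last by apply: slit_star; rewrite ?(ltW t0).
rewrite [t%:K * z]mulrC mulrAC mulfK//.
by rewrite -normc_gt0 normcR normr_gt0 gt_eqF.
Qed.

Lemma polylogS k z : polylog k.+2 z =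
  cintegral01 (fun t => polylog k.+1 (t%:K * z) / t%:K).
Proof. by []. Qed.

Lemma polylog_div_le (x B : R) k n t : 0 <= x -> 0 <= t <= 1 -> 0 <= B ->
  (0 < t -> normc (polylog k ((t * x)%:K * lowdir n)) <= (t * x) * B) ->
  normc (polylog k (t%:K * (x%:K * lowdir n)) / t%:K) <= x * B.
Proof.
move=> x0 /andP[t0 t1] B0 H; rewrite mulrA -rmorphM normcM normcV normcR (ger0_norm t0).
move: t0; rewrite le_eqVlt => /predU1P[<-|t0]; first by rewrite invr0 mulr0 mulr_ge0.
by rewrite ler_pdivrMr// (le_trans (H t0))//; lra.
Qed.

(** One integration absorbs the singularity of Li_1; after that, a bound
    linear in x is reproduced by each integration, up to a factor 2. *)
Lemma polylogS_le k : exists2 C : R, 0 <= C & forall (x : R) n, 0 <= x ->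
  normc (polylog k.+2 (x%:K * lowdir n)) <= x * C.
Proof.
elim: k => [|k [C C0 IH]].
  exists (2 * (20 + 16 * 18)) => [|x n x0]; first by rewrite mulr_ge0.
  have Dz := slit_lowdir n x0; rewrite polylogS.
  have iB : mu.-integrable `[0, 1]
      (EFin \o (fun t => x * (20 + 16 * rsqrt (1 - t%:K * (x%:K * lowdir n))))).
    have := integrableD (@measurable01 R) (integrable01_cst (x * 20))
      (integrableZl (@measurable01 R) (x * 16) (rsqrt_integrable Dz)).
    apply: eq_integrable => // t _ /=.
    by rewrite -EFinM -EFinD; congr EFin; ring.
  apply: le_trans (le_norm_cint_fun (polylog_ray_integrable 1 Dz) iB _) _.
    move=> t /andP[t0 t1]; apply: polylog_div_le; rewrite ?t0//.
      by rewrite addr_ge0 ?mulr_ge0 ?rsqrt_ge0.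
    move=> _; rewrite mulrA -rmorphM; apply: polylog1_le.
    by rewrite mulr_ge0.
  rewrite [leRHS]mulrCA ler_wpM2l//.
  have i1 := integrable01_cst (20 : R).
  have i2 : mu.-integrable `[0, 1] (EFin \o (fun t => 16 * rsqrt (1 - t%:K * (x%:K * lowdir n)))).
    have := integrableZl (@measurable01 R) 16 (rsqrt_integrable Dz).
    by apply: eq_integrable => // t _ /=; rewrite EFinM.
  have i3 : mu.-integrable `[0, 1] (EFin \o (fun t => 20 + 16 * rsqrt (1 - t%:K * (x%:K * lowdir n)))).
    have := integrableD (@measurable01 R) i1 i2.
    by apply: eq_integrable => // t _ /=; rewrite EFinD.
  rewrite RintegralZl// ler_wpM2l// RintegralD// Rint01_cst lerD2l.
  rewrite RintegralZl ?rsqrt_integrable// ler_wpM2l//.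
  exact: rsqrt_int_le.
exists (2 * C) => [|x n x0]; first by rewrite mulr_ge0.
rewrite polylogS mulrCA; apply: le_norm_cint.
  exact/polylog_ray_integrable/slit_lowdir.
move=> t t01; apply: polylog_div_le => //.
by move=> _; apply: IH; have /andP[? _] := t01; rewrite mulr_ge0.
Qed.

Lemma cArg_pos (x : R) : 0 < x -> cArg (x%:K : cplx R) = 0.
Proof.
move=> x0; rewrite /cArg /= lexx expr0n addr0 sqrtr_sqr gtr0_norm//.
by rewrite divff ?gt_eqF// acos1.
Qed.

(** It replaces arguments near the negative axis by arguments near the
    positive one, where Log is continuous. *)
Lemma cLog_upper w : 0 < Im w \/ (Im w = 0 /\ Re w < 0) ->
  cLog w = cLog (- w) + (0 +i* pi)%C.
Proof.
move=> Hw; have w0 : w != 0.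
  by apply/eqP => w0; case: Hw => [|[_]]; rewrite w0 /= ltxx.
have pi0 := pi_gt0 R.
apply: cexp_uniq.
  rewrite cexpD !cLogK ?oppr_eq0//.
  have -> : cexp ((0 +i* pi)%C : cplx R) = -1.
    by rewrite /cexp /= expR0 cospi sinpi !mul1r; apply: cplx_eq => //=; rewrite oppr0.
  by rewrite mulrN1 opprK.
rewrite ImD /=.
have /andP[a1 a2] := cArg_itv w0.
have nw0 : - w != 0 by rewrite oppr_eq0.
have /andP[b1 b2] := cArg_itv nw0.
have a0 : 0 <= cArg w.
  rewrite /cArg; have [_ bnd] := normc_bound w0.
  have -> : 0 <= Im w by case: Hw => [/ltW//|[->]].
  exact: acos_ge0.
have b0 : cArg (- w) <= 0.
  have [_ bnd] := normc_bound nw0.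
  case: Hw => [Iw|[I0 Rw]].
    by rewrite /cArg ImN oppr_ge0 [Im w <= 0]leNgt Iw /= oppr_le0 acos_ge0.
  have -> : - w = (- Re w)%:K by apply: cplx_eq; rewrite ?ReN ?ImN//= I0 oppr0.
  by rewrite (cArg_pos (_ : 0 < - Re w))// oppr_gt0.
by rewrite ltr_norml; apply/andP; split; lra.
Qed.

Lemma polylog1_bdry (x : R) : 0 <= x -> x != 1 ->
  (fun n => polylog 1 (x%:K * lowdir n)) @ \oo --> polylog 1 x%:K.
Proof.
move=> x0 x1.
suff : (fun n => cLog (1 - x%:K * lowdir n)) @ \oo --> cLog (1 - x%:K).
  by move=> H; exact: (seq_cvgN H).
have D : (fun n => 1 - x%:K * lowdir n) @ \oo --> 1 - x%:K.
  exact: (seq_cvgB (@seq_cvg_cst R 1) (@cvg_lowdir R x)).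
have [xlt|xgt] : x < 1 \/ 1 < x by apply/orP; rewrite -neq_lt.
  apply: (cvg_comp _ _ D); apply: cder_cts (cLog_derive _).
  by left; rewrite ReB /= subr_gt0.
have D' : (fun n => - (1 - x%:K * lowdir n)) @ \oo --> - (1 - x%:K).
  exact: (seq_cvgN D).
have E n : cLog (1 - x%:K * lowdir n) = cLog (- (1 - x%:K * lowdir n)) + (0 +i* pi)%C.
  apply: cLog_upper; left; rewrite ImB ImZ /= mulrN opprK add0r.
  by rewrite divr_gt0// (lt_trans ltr01).
have -> : (fun n => cLog (1 - x%:K * lowdir n)) =
  (fun n => cLog (- (1 - x%:K * lowdir n)) + (0 +i* pi)%C) by apply/funext.
rewrite cLog_upper; last by right; rewrite ImB ReB /= subr0 subr_lt0.
have L : (fun n => cLog (- (1 - x%:K * lowdir n))) @ \oo --> cLog (- (1 - x%:K)).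
  apply: (cvg_comp _ _ D'); apply: cder_cts (cLog_derive _).
  by left; rewrite ReN ReB /= opprB subr_gt0.
exact: (seq_cvgD L (@seq_cvg_cst R _)).
Qed.

Lemma polylog_dominated k (x : R) : 0 <= x -> exists g : R -> \bar R,
  mu.-integrable `[0, 1] g /\ forall n t, 0 <= t <= 1 ->
    ((normc (polylog k.+1 (t%:K * (x%:K * lowdir n)) / t%:K))%:E <= g t)%E.
Proof.
move=> x0; case: k => [|k].
  have [g [ig gP]] := rsqrt_lowdir_majorant x0.
  (* The bound of [polylog1_le] at t x, divided by t. *)
  exists (fun t => (x * 20)%:E + (x * 16)%:E * g t)%E; split.
    have := integrableD (@measurable01 R) (integrable01_cst (x * 20))
      (integrableZl (@measurable01 R) (x * 16) ig).
    exact: eq_integrable.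
  move=> n t t01; have /andP[t0 t1] := t01; apply: (@le_trans _ _
    (x * (20 + 16 * rsqrt (1 - t%:K * (x%:K * lowdir n))))%:E).
    rewrite lee_fin; apply: polylog_div_le => //.
      by rewrite addr_ge0 ?mulr_ge0 ?rsqrt_ge0.
    move=> _; rewrite mulrA -rmorphM; apply: polylog1_le.
    by rewrite mulr_ge0.
  rewrite mulrDr mulrA EFinD EFinM leeD2l// [leLHS]EFinM lee_wpmul2l ?lee_fin ?mulr_ge0//.
  exact: gP.
have [C C0 H] := polylogS_le k.
exists (fun=> (x * C)%:E); split; first exact: (integrable01_cst (x * C)).
move=> n t t01; rewrite lee_fin; apply: polylog_div_le => //.
by have /andP[t0 _] := t01; move=> _; apply: H; rewrite mulr_ge0.
Qed.

(** The exceptional point of the dominated convergence is t = 1 / x,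
    where t x is the branch point. *)
Lemma polylog_bdry_step k (x : R) : 0 <= x ->
  (forall y : R, 0 <= y -> (k = 0%N -> y != 1) ->
    (fun n => polylog k.+1 (y%:K * lowdir n)) @ \oo --> polylog k.+1 y%:K) ->
  cintegrable (fun t => polylog k.+1 (t%:K * x%:K) / t%:K) /\
  (fun n => polylog k.+2 (x%:K * lowdir n)) @ \oo --> polylog k.+2 x%:K.
Proof.
move=> x0 IH; have [g [ig gP]] := polylog_dominated k x0.
have ci n := polylog_ray_integrable k.+1 (slit_lowdir n x0).
have cv t : 0 <= t <= 1 -> t != x^-1 ->
  (fun n => polylog k.+1 (t%:K * (x%:K * lowdir n)) / t%:K) @ \oo -->
    polylog k.+1 (t%:K * x%:K) / t%:K.
  move=> /andP[t0 t1] tx; apply: cvgMl; rewrite -rmorphM.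
  under eq_cvg do rewrite mulrA -rmorphM.
  apply: IH; first by rewrite mulr_ge0.
  move=> _; apply: contra tx => /eqP tx1.
  have xn0 : x != 0.
    by apply/eqP => x00; move: tx1; rewrite x00 mulr0 => /eqP; rewrite eq_sym oner_eq0.
  by rewrite -(mulfK xn0 t) tx1 mul1r.
have D (pr : cplx R -> R) : (forall u, `|pr u| <= normc u) ->
    (forall n, mu.-integrable `[0, 1]
      (EFin \o (fun t => pr (polylog k.+1 (t%:K * (x%:K * lowdir n)) / t%:K)))) ->
    (forall t, 0 <= t <= 1 -> t != x^-1 ->
      (fun n => pr (polylog k.+1 (t%:K * (x%:K * lowdir n)) / t%:K)) @ \oo -->
        pr (polylog k.+1 (t%:K * x%:K) / t%:K)) ->
    mu.-integrable `[0, 1]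
      (EFin \o (fun t => pr (polylog k.+1 (t%:K * x%:K) / t%:K))) /\
    (fun n => \int[mu]_(t in `[0, 1]) pr (polylog k.+1 (t%:K * (x%:K * lowdir n)) / t%:K))
      @ \oo --> \int[mu]_(t in `[0, 1]) pr (polylog k.+1 (t%:K * x%:K) / t%:K).
  move=> prn pri prc; apply: (Rint01_dct pri prc ig) => n t t01.
  by apply: le_trans (gP n t t01); rewrite lee_fin prn.
have [ri rc] := D (@complex.Re R) (@normRe_le R) (fun n => (ci n).1)
  (fun t t01 tx => ((cvg_ReIm _ _).1 (cv t t01 tx)).1).
have [mi mc] := D (@complex.Im R) (@normIm_le R) (fun n => (ci n).2)
  (fun t t01 tx => ((cvg_ReIm _ _).1 (cv t t01 tx)).2).
by split; [split|apply/cvg_ReIm; split].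
Qed.

(** From below, and not from above, because 1 - x < 0 has argument pi and
    not -pi.  At x = 1 the logarithm Li_1 has no limit. *)
Lemma polylog_bdry k (x : R) : 0 <= x -> (k = 0%N -> x != 1) ->
  (fun n => polylog k.+1 (x%:K * lowdir n)) @ \oo --> polylog k.+1 x%:K.
Proof.
elim: k x => [|k IH] x x0 x1; first by apply: polylog1_bdry; last exact: x1.
exact: (polylog_bdry_step x0 IH).2.
Qed.

Lemma polylog_real_integrable k (x : R) : 0 <= x ->
  cintegrable (fun t => polylog k.+1 (t%:K * x%:K) / t%:K).
Proof. by move=> x0; exact: (polylog_bdry_step x0 (@polylog_bdry k)).1. Qed.

End BoundaryLimits.

(** * Imaginary part on the cut *)

Section CutValues.
Variable R : realType.
Implicit Types (x y z w a b c h : cplx R) (t : R).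
Local Notation mu := (@lebesgue_measure R).
Local Notation cj := (@conjc R).

Lemma cjM x y : cj (x * y) = cj x * cj y. Proof. exact: (rmorphM (@conjc R)). Qed.
Lemma cjB x y : cj (x - y) = cj x - cj y. Proof. exact: (rmorphB (@conjc R)). Qed.
Lemma cj1 : cj 1 = 1. Proof. exact: (rmorph1 (@conjc R)). Qed.
Lemma cjV x : cj x^-1 = (cj x)^-1. Proof. exact: (fmorphV (@conjc R)). Qed.
Lemma cjR t : cj t%:K = t%:K. Proof. by apply: cplx_eq => //=; rewrite oppr0. Qed.
Lemma Re_cj z : Re (cj z) = Re z. Proof. by case: z. Qed.
Lemma Im_cj z : Im (cj z) = - Im z. Proof. by case: z. Qed.

Lemma normc_cj z : normc (cj z) = normc z.
Proof. by case: z => a b /=; rewrite sqrrN. Qed.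

Lemma cj_ray t z : 1 - t%:K * cj z = cj (1 - t%:K * z).
Proof. by rewrite cjB cj1 cjM cjR. Qed.

Lemma slit_cj z : slit z -> slit (cj z).
Proof.
by move=> Dz t t01; rewrite cj_ray -normc_gt0 normc_cj normc_gt0 Dz.
Qed.

Lemma cint_cj (f : R -> cplx R) : cintegrable f ->
  cintegral01 (fun t => cj (f t)) = cj (cintegral01 f).
Proof.
move=> [rf mf]; apply: cplx_eq; rewrite ?Re_cj ?Im_cj /=.
  by under eq_Rintegral do rewrite Re_cj.
under eq_Rintegral do rewrite Im_cj -mulN1r.
by rewrite RintegralZl// mulN1r.
Qed.

Lemma slope_cj k z : slit z -> slope k (cj z) = cj (slope k z).
Proof.
elim: k z => [|k IH] z Dz; first by rewrite /= cjV cjB cj1.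
rewrite -[slope k.+1 z]/(rayint (slope k) z) -[slope k.+1 _]/(rayint (slope k) _) /rayint.
rewrite -(cint_cj (cintegrable_path (rayC2_path (slope_rayC2 k) Dz))).
have P t : 0 < t <= 1 -> slope k (t%:K * cj z) = cj (slope k (t%:K * z)).
  move=> /andP[/ltW t0 t1]; have -> : t%:K * cj z = cj (t%:K * z) by rewrite cjM cjR.
  by apply: IH; apply: slit_star; rewrite ?t0.
have i := cintegrable_path (rayC2_path (slope_rayC2 k) (slit_cj Dz)).
by have [_ ->] := eq_cint i (fun t t01 => esym (P t t01)).
Qed.

Lemma polylog_cj k z : slit z -> polylog k (cj z) = cj (polylog k z).
Proof. by move=> Dz; rewrite (polylog_ray k (slit_cj Dz)) (polylog_ray k Dz) (slope_cj k Dz) cjM. Qed.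

Lemma Im_polylog_lt1 k (x : R) : x < 1 -> Im (polylog k x%:K) = 0.
Proof.
move=> x1; have Dx : slit x%:K by apply: slit_ReIm; left.
have /(congr1 (@complex.Im R)) := polylog_cj k Dx; rewrite cjR Im_cj.
by move=> h; lra.
Qed.

Lemma is_derive_ln_scale (x t : R) : 0 < x -> 0 < t ->
  is_derive t 1 (fun s : R => ln (s * x)) t^-1.
Proof.
move=> x0 t0; have tx : 0 < t * x by rewrite mulr_gt0.
have d1 : is_derive t 1 (fun s : R => s * x) x.
  apply: is_derive_real => e e0; exists 1 => // r _.
  have -> : r * x - t * x - (r - t) * x = 0 by ring.
  by rewrite normr0 mulr_ge0// ltW.
have H := @is_derive1_comp R (@ln R) (fun s => s * x) t _ _ (is_derive1_ln tx) d1.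
by apply: (is_derive_eq H); field; rewrite !gt_eqF.
Qed.

Lemma ln_pow_cts k (x t : R) : 0 < x -> 0 < t ->
  {for t, continuous (fun s : R => s^-1 * (ln (s * x) ^+ k / k`!%:R))}.
Proof.
move=> x0 t0.
have cV : {for t, continuous (fun s : R => s^-1)}.
  by apply: inv_continuous; rewrite gt_eqF.
have cl : {for t, continuous (fun s : R => ln (s * x))}.
  by have [/derivable1_diffP/differentiable_continuous] := is_derive_ln_scale x0 t0.
have cp : {for t, continuous (fun s : R => ln (s * x) ^+ k)}.
  exact: (continuous_comp cl (@exprn_continuous R k _)).
have cc : {for t, continuous (fun s : R => k`!%:R^-1 : R)} by exact: cst_continuous.
exact: (continuousM cV (continuousM cp cc)).
Qed.

Lemma Rint_ln_pow k (x : R) : 1 < x ->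
  \int[mu]_(t in `[x^-1, 1]) (t^-1 * (ln (t * x) ^+ k / k`!%:R)) =
  ln x ^+ k.+1 / k.+1`!%:R.
Proof.
move=> x1; have x0 : 0 < x by exact: lt_trans x1.
have c0 : 0 < x^-1 by rewrite invr_gt0.
pose G t : R := ln (t * x) ^+ k.+1 / k.+1`!%:R.
pose g t : R := t^-1 * (ln (t * x) ^+ k / k`!%:R).
have dl t := @is_derive_ln_scale x t x0.
have dG t : 0 < t -> is_derive t 1 G (g t).
  move=> t0; have H := is_deriveX k.+1 (dl t t0).
  have H2 := is_deriveZ (k.+1`!%:R^-1) H.
  have -> : G = k.+1`!%:R^-1 \*: ((fun s : R => ln (s * x)) ^+ k.+1).
    by apply/funext => s; rewrite /G mulrC exprfctE.
  apply: (is_derive_eq H2); rewrite /GRing.scale/= /g factS natrM.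
  by field; rewrite nat1r !pnatr_eq0 -!lt0n fact_gt0 gt_eqF.
have cg t := @ln_pow_cts k x t x0.
have cG t : 0 < t -> {for t, continuous G}.
  by move=> /dG[/derivable1_diffP/differentiable_continuous].
have c1 : x^-1 < 1 by rewrite invf_lt1.
rewrite /Rintegral (continuous_FTC2 c1 (F := G))//.
- by rewrite /G mul1r mulVf ?gt_eqF// ln1 expr0n/= mul0r subr0.
- apply: continuous_in_subspaceT => t /[!inE]/=; rewrite in_itv/= => /andP[ct _].
  by apply: cg; exact: lt_le_trans ct.
- split.
  + move=> t; rewrite in_itv/= => /andP[ct _].
    by have [] := dG t (lt_trans c0 ct).
  + by apply: cvg_at_right_filter; exact: cG.
  + by apply: cvg_at_left_filter; exact: cG.
- move=> t; rewrite in_itv/= => /andP[ct _].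
  by rewrite derive1E; have [] := dG t (lt_trans c0 ct).
Qed.

(** Since Li_k is real on [0, 1[, only the part t > 1 / x of the ray
    contributes to the imaginary part. *)
Lemma Im_polylog_cut k (x : R) : 1 < x ->
  Im (polylog k.+1 x%:K) = - pi * (ln x ^+ k / k`!%:R).
Proof.
elim: k x => [|k IH] x x1; have x0 : 0 < x by exact: lt_trans x1.
  rewrite expr0 fact0 divr1 mulr1 [polylog 1 _]/= ImN.
  rewrite cLog_upper; last by right; rewrite ImB ReB /= subr0 subr_lt0.
  have -> : - (1 - x%:K) = (x - 1)%:K by rewrite opprB rmorphB.
  by rewrite ImD [Im (cLog _)]/= cArg_pos ?subr_gt0// add0r.
pose f t := Im (polylog k.+1 (t%:K * x%:K) / t%:K).
have fE t : f t = t^-1 * Im (polylog k.+1 (t * x)%:K).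
  by rewrite /f mulrC -fmorphV ImZ rmorphM.
have [_ fi] := polylog_real_integrable k (ltW x0).
have c0 : 0 < x^-1 by rewrite invr_gt0.
have c1 : x^-1 < 1 by rewrite invf_lt1.
rewrite -[LHS]/(\int[mu]_(t in `[0, 1]) f t).
have := Rintegral_itvB fi (_ : (BLeft 0 <= BRight x^-1)%O) (_ : (BRight x^-1 <= BRight 1)%O).
rewrite !bnd_simp => /(_ (ltW c0) (ltW c1)).
have -> : \int[mu]_(t in `[0, x^-1]) f t = 0.
  have i1 : mu.-integrable `[0, x^-1] (EFin \o f).
    by apply: integrableS fi => //; apply: subset_itv; rewrite bnd_simp// ltW.
  rewrite -Rintegral_itv_bndo_bndc; last first.
    by apply: integrableS i1 => //; apply: subset_itv; rewrite bnd_simp.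
  rewrite -Rintegral_itv_obnd_cbnd; last first.
    by apply: integrableS i1 => //; apply: subset_itv; rewrite bnd_simp.
  rewrite -[RHS](mul0r (fine (mu `]0, x^-1[))) -Rintegral_cst//.
  apply: eq_Rintegral => t /[!inE]/=; rewrite in_itv/= => /andP[t0 tc].
  by rewrite fE Im_polylog_lt1 ?mulr0// -ltr_pdivlMr// div1r.
rewrite subr0 => ->.
pose g t : R := t^-1 * (ln (t * x) ^+ k / k`!%:R).
have gi : mu.-integrable `[x^-1, 1] (EFin \o g).
  apply: continuous_compact_integrable; first exact: segment_compact.
  apply: continuous_in_subspaceT => t /[!inE]/=; rewrite in_itv/= => /andP[ct _].
  by apply: ln_pow_cts => //; exact: lt_le_trans c0 ct.
have gi' : mu.-integrable `]x^-1, 1] (EFin \o g).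
  by apply: integrableS gi => //; apply: subset_itv; rewrite bnd_simp.
rewrite -Rint_ln_pow// -Rintegral_itv_obnd_cbnd// -RintegralZl//.
apply: eq_Rintegral => t /[!inE]/=; rewrite in_itv/= => /andP[ct t1].
have tx : 1 < t * x by rewrite -ltr_pdivrMr// div1r.
by rewrite -/(f t) fE IH// mulrCA.
Qed.

End CutValues.

(** * Continuation across the cut *)

Section Continuation.
Variable R : realType.
Implicit Types (x y z w a b c h : cplx R) (t : R).
Local Notation cj := (@conjc R).
Local Notation lowdir := (@lowdir R).

(** Coefficients of the polynomial in Log z of the inversion formula, that of
    Log(z)^j / j! in position j.  Passing from k to k + 1 integrates the polynomial,
    which shifts the list; the new constant of integration gives [cont_polylog k] and
    [polylog k] the same value at 2, see [cont_polylog2]. *)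
Fixpoint inv_coefs (k : nat) : seq (cplx R) :=
  if k is k'.+1 then
    (polylog k 2 + (-1) ^+ k * polylog k 2^-1
     - \sum_(0 <= j < k) (inv_coefs k')`_j * (cLog 2 ^+ j.+1 / j.+1`!%:R))
    :: inv_coefs k'
  else [:: -1].

Definition inv_poly k z : cplx R :=
  \sum_(0 <= j < k.+1) (inv_coefs k)`_j * (cLog z ^+ j / j`!%:R).

(** The right-hand side of the inversion formula
    Li_k(z) = -(-1)^k Li_k(1/z) + (polynomial in Log z).  For Re z > 1 the point 1/z
    is off the cut and z off the cut of Log, so that the expression is holomorphic
    across ]1, +oo[. *)
Definition cont_polylog k z : cplx R :=
  - (-1) ^+ k * polylog k z^-1 + inv_poly k z.

Lemma inv_polyS k z : inv_poly k.+1 z = (inv_coefs k.+1)`_0 +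
  \sum_(0 <= j < k.+1) (inv_coefs k)`_j * (cLog z ^+ j.+1 / j.+1`!%:R).
Proof. by rewrite /inv_poly big_nat_recl// expr0 fact0 invr1 !mulr1. Qed.

Lemma cder_Log_exp k z : 0 < Re z ->
  is_derive z 1 (fun w => cLog w ^+ k.+1 / k.+1`!%:R) (cLog z ^+ k / k`!%:R / z).
Proof.
move=> Rz; have H := cderM (cder_exp k.+1 (cLog_derive (or_introl Rz)))
  (cder_cst k.+1`!%:R^-1 z).
have z0 : z != 0 by apply/eqP => z0; rewrite z0 /= ltxx in Rz.
apply: (is_derive_eq H); rewrite mulr0 addr0 factS natrM /=.
by field; rewrite nat1r z0 !pnatr_eq0 -!lt0n fact_gt0.
Qed.

Lemma inv_poly_derive k z : 0 < Re z ->
  is_derive z 1 (inv_poly k.+1) (inv_poly k z / z).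
Proof.
move=> Rz; have H := @cder_sum R
  (fun j w => (inv_coefs k)`_j * (cLog w ^+ j.+1 / j.+1`!%:R)) _ z k.+1
  (fun j _ => cderZ _ (cder_Log_exp j Rz)).
have H1 := cderD (cder_cst (inv_coefs k.+1)`_0 z) H.
have -> : inv_poly k.+1 = (fun w => (inv_coefs k.+1)`_0 +
  \sum_(0 <= j < k.+1) (inv_coefs k)`_j * (cLog w ^+ j.+1 / j.+1`!%:R)).
  by apply/funext => w; exact: inv_polyS.
apply: (is_derive_eq H1); rewrite add0r /inv_poly mulr_suml.
by apply: eq_bigr => j _; rewrite !mulrA.
Qed.

Lemma slitV z : 1 < Re z -> slit z^-1.
Proof.
move=> z1; apply: slit_ReIm; left; rewrite ReV.
have z0 : 0 < Re z := lt_trans ltr01 z1.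
have z2 : Re z < Re z ^+ 2 by rewrite expr2 ltr_pMr.
have z3 : 0 <= Im z ^+ 2 by rewrite sqr_ge0.
by rewrite ltr_pdivrMr ?mul1r; lra.
Qed.

Lemma Re_gt1_neq0 z : 1 < Re z -> z != 0.
Proof. by move=> z1; apply/eqP => z0; move: z1; rewrite z0 /= ltr10. Qed.

Lemma cont_polylog0 z : 1 < Re z -> cont_polylog 0 z = polylog 0 z.
Proof.
move=> z1; have z0 := Re_gt1_neq0 z1.
have zn1 : 1 - z != 0.
  by apply/eqP => /(congr1 (@complex.Re R)); rewrite ReB /=; lra.
have zn1' : z - 1 != 0 by rewrite -oppr_eq0 opprB.
rewrite /cont_polylog /inv_poly big_nat1 /= expr0 fact0.
by field; rewrite z0 zn1 zn1'.
Qed.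

Lemma cont_polylog_derive k z : 1 < Re z ->
  is_derive z 1 (cont_polylog k.+1) (cont_polylog k z / z).
Proof.
move=> z1; have z0 := Re_gt1_neq0 z1; have Dz := slitV z1.
have H := cderD (cderZ (- (-1) ^+ k.+1) (cder_comp (cder_inv z0) (polylog_derive k Dz)))
  (inv_poly_derive k (lt_trans ltr01 z1)).
apply: (is_derive_eq H); rewrite /cont_polylog (polylog_ray k Dz) exprS.
by field.
Qed.

Lemma cont_polylog2 k : cont_polylog k.+1 2 = polylog k.+1 2.
Proof.
rewrite /cont_polylog inv_polyS.
have -> : (inv_coefs k.+1)`_0 = polylog k.+1 2 + (-1) ^+ k.+1 * polylog k.+1 2^-1
  - \sum_(0 <= j < k.+1) (inv_coefs k)`_j * (cLog 2 ^+ j.+1 / j.+1`!%:R) by [].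
set S := \sum_(0 <= j < _) _; set p := polylog _ 2; set q := polylog _ _.
by ring.
Qed.

(** By how much Li_k increases, from below to above, across ]1, +oo[; the
    rational function Li_0 has no cut. *)
Definition jump k z : cplx R :=
  if k is k'.+1 then twopii R * (cLog z ^+ k' / k'`!%:R) else 0.

Lemma jump_derive k z : 0 < Re z -> is_derive z 1 (jump k.+1) (jump k z / z).
Proof.
move=> Rz; case: k => [|k].
  rewrite mul0r; have -> : jump 1 = (fun=> twopii R).
    by apply/funext => w; rewrite /jump expr0 fact0 divr1 mulr1.
  exact: cder_cst.
by have := cderZ (twopii R) (cder_Log_exp k Rz); rewrite mulrA.
Qed.

Lemma cvg_const_eq0 (D : cplx R -> cplx R) (u : nat -> cplx R) z :
  (forall n, D (u n) = D z) -> (fun n => D (u n)) @ \oo --> (0 : cplx R) -> D z = 0.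
Proof.
move=> Du; have -> : (fun n => D (u n)) = (fun=> D z) by apply/funext.
by move=> H; apply: (cvg_unique _ (@seq_cvg_cst R (D z)) H).
Qed.

Lemma cts_seq (f : cplx R -> cplx R) (u : nat -> cplx R) (l : cplx R) :
  {for l, continuous f} -> u @ \oo --> l -> (fun n => f (u n)) @ \oo --> f l.
Proof. by move=> cf ul; exact: (cvg_comp _ _ ul cf). Qed.

Lemma derive0_const (P : cplx R -> Prop) (D : cplx R -> cplx R) :
  (forall a b t, P a -> P b -> 0 <= t <= 1 -> P (a + t%:K * (b - a))) ->
  (forall a, P a -> is_derive a 1 D 0) ->
  forall a b, P a -> P b -> D b = D a.
Proof.
move=> cP dD a b Pa Pb; rewrite -{1}(subrKC a b).
by apply: derive0_line => t t01; apply/dD/cP.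
Qed.

Lemma convex_quadrant (s : R) a b t : 0 <= t <= 1 ->
  1 < Re a /\ 0 < s * Im a -> 1 < Re b /\ 0 < s * Im b ->
  1 < Re (a + t%:K * (b - a)) /\ 0 < s * Im (a + t%:K * (b - a)).
Proof.
move=> /andP[t0 t1] [a1 a2] [b1 b2].
have conv (p q r : R) : r < p -> r < q -> r < p + t * (q - p).
  move=> rp rq; have h1 : 0 <= t * (q - r) by rewrite mulr_ge0// subr_ge0 ltW.
  have h2 : 0 <= (1 - t) * (p - r) by rewrite mulr_ge0 ?subr_ge0 ?(ltW rp).
  have [->|tn0] := eqVneq t 0; first by rewrite mul0r addr0.
  have h3 : 0 < t * (q - r) by rewrite mulr_gt0 ?subr_gt0// lt0r tn0.
  by lra.
rewrite ReD ImD ReZ ImZ ReB ImB; split; first exact: conv.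
by have := conv _ _ _ a2 b2; rewrite -mulrBr mulrCA -mulrDr.
Qed.

Lemma slit_Im z : Im z != 0 -> slit z.
Proof. by move=> h; apply: slit_ReIm; right. Qed.

(** By induction on k both sides have the same derivative below the
    cut, and they have the same limit at 2 from below.  On the cut both are limits
    from below. *)
Lemma cont_polylog_lower k z : 1 < Re z -> Im z <= 0 ->
  polylog k z = cont_polylog k z.
Proof.
elim: k z => [|k IH] z z1 z0; first by rewrite cont_polylog0.
have open_case w : 1 < Re w -> Im w < 0 -> polylog k.+1 w = cont_polylog k.+1 w.
  move=> w1 w0; apply/eqP; rewrite -subr_eq0; apply/eqP.
  pose D v := polylog k.+1 v - cont_polylog k.+1 v.
  (* D is constant below the cut, and tends to 0 along this sequence. *)
  apply: (@cvg_const_eq0 D (fun n => (2 : R)%:K * lowdir n)).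
    move=> n; apply: (@derive0_const (fun a => 1 < Re a /\ 0 < -1 * Im a)).
    - by move=> a b t Pa Pb t01; exact: convex_quadrant.
    - move=> a [a1 a2]; have a0 := Re_gt1_neq0 a1.
      have Da : slit a by apply: slit_Im; rewrite lt_eqF//; lra.
      have H := cderB (polylog_derive k Da) (cont_polylog_derive k a1).
      apply: (is_derive_eq H); rewrite -IH//; last by lra.
      by rewrite polylog_ray//; field.
    - by split => //; lra.
    - rewrite ReZ ImZ /=; split; first by rewrite mulr1 ltr1n.
      by rewrite mulN1r mulrN opprK mulr_gt0 ?invr_gt0.
  have -> : (0 : cplx R) = polylog k.+1 (2 : R)%:K - cont_polylog k.+1 (2 : R)%:K.
    have -> : (2 : R)%:K = 2 :> cplx R by rewrite rmorph_nat.
    by rewrite cont_polylog2 subrr.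
  apply: seq_cvgB; first by apply: polylog_bdry => // _; rewrite gt_eqF// ltr1n.
  apply: cts_seq (@cvg_lowdir R 2); apply: cder_cts (cont_polylog_derive k _).
  by rewrite /= ltr1n.
move: z0; rewrite le_eqVlt => /predU1P[z0|z0]; last exact: open_case.
have zE : z = (Re z)%:K by apply: cplx_eq.
rewrite zE; have x0 : 0 < Re z := lt_trans ltr01 z1.
have H1 := @polylog_bdry R k (Re z) (ltW x0) (fun _ => negbT (gt_eqF z1)).
have H2 : (fun n => cont_polylog k.+1 ((Re z)%:K * lowdir n)) @ \oo -->
    cont_polylog k.+1 (Re z)%:K.
  by apply: cts_seq (@cvg_lowdir R _); apply: cder_cts (cont_polylog_derive k _).
have EF : (fun n => polylog k.+1 ((Re z)%:K * lowdir n)) =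
    (fun n => cont_polylog k.+1 ((Re z)%:K * lowdir n)).
  apply/funext => n; apply: open_case; first by rewrite ReZ /= mulr1.
  by rewrite ImZ /= mulrN oppr_lt0 divr_gt0.
by rewrite EF in H1; exact: (cvg_unique _ H1 H2).
Qed.

Lemma seq_cvg_cj (u : nat -> cplx R) (l : cplx R) :
  u @ \oo --> l -> (fun n => cj (u n)) @ \oo --> (cj l : cplx R).
Proof.
move=> /cvg_ReIm[u1 u2]; apply/cvg_ReIm; rewrite Re_cj Im_cj; split.
  by have -> : (fun n => Re (cj (u n))) = (fun n => Re (u n)) by apply/funext => n; rewrite Re_cj.
have -> : (fun n => Im (cj (u n))) = (fun n => - Im (u n)) by apply/funext => n; rewrite Im_cj.
exact: cvgN.
Qed.

(** By conjugation the limit of Li_k at 2 from above is the conjugate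
    of its value there, so the two sides differ in the limit by twice an imaginary
    part, which is that of a jump. *)
Lemma cont_polylog_upper k z : 1 < Re z -> 0 < Im z ->
  polylog k z - jump k z = cont_polylog k z.
Proof.
elim: k z => [|k IH] z z1 z0; first by rewrite cont_polylog0//= subr0.
apply/eqP; rewrite -subr_eq0; apply/eqP.
pose D v := polylog k.+1 v - jump k.+1 v - cont_polylog k.+1 v.
(* The same argument above the cut, along the conjugate sequence. *)
apply: (@cvg_const_eq0 D (fun n => cj ((2 : R)%:K * lowdir n))).
  move=> n; apply: (@derive0_const (fun a => 1 < Re a /\ 0 < 1 * Im a)).
  - by move=> a b t Pa Pb t01; exact: convex_quadrant.
  - move=> a [a1 a2]; have a0 := Re_gt1_neq0 a1.
    have Da : slit a by apply: slit_Im; rewrite gt_eqF//; lra.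
    have H := cderB (cderB (polylog_derive k Da) (jump_derive k (lt_trans ltr01 a1)))
      (cont_polylog_derive k a1).
    apply: (is_derive_eq H); rewrite -IH//; last by lra.
    by rewrite polylog_ray//; field.
  - by split => //; lra.
  - rewrite Re_cj Im_cj ReZ ImZ /=; split; first by rewrite mulr1 ltr1n.
    by rewrite mul1r mulrN opprK mulr_gt0 ?invr_gt0.
have C : (fun n => cj ((2 : R)%:K * lowdir n)) @ \oo --> (2 : R)%:K.
  by have := seq_cvg_cj (@cvg_lowdir R 2); rewrite cjR.
have P := @polylog_bdry R k 2 (ler0n _ _) (fun _ => negbT (gt_eqF (ltr1n _ 2))).
have P' : (fun n => polylog k.+1 (cj ((2 : R)%:K * lowdir n))) @ \oo --> (cj (polylog k.+1 (2 : R)%:K) : cplx R).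
  have -> : (fun n => polylog k.+1 (cj ((2 : R)%:K * lowdir n))) =
      (fun n => cj (polylog k.+1 ((2 : R)%:K * lowdir n))).
    by apply/funext => n; rewrite polylog_cj//; exact: slit_lowdir.
  exact: seq_cvg_cj.
have -> : (0 : cplx R) = cj (polylog k.+1 (2 : R)%:K) - jump k.+1 (2 : R)%:K - cont_polylog k.+1 (2 : R)%:K.
  have E2 : (2 : R)%:K = 2 :> cplx R by rewrite rmorph_nat.
  have -> : cont_polylog k.+1 (2 : R)%:K = polylog k.+1 (2 : R)%:K.
    by rewrite E2 cont_polylog2.
  have l2 : cLog ((2 : R)%:K : cplx R) = (ln 2)%:K.
    by rewrite /cLog cArg_pos// normcR ger0_norm.
  rewrite /jump l2 -rmorphXn -[k`!%:R](rmorph_nat (real_complex R)) -fmorphV -rmorphM.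
  have Imp := @Im_polylog_cut R k 2 (ltr1n _ 2).
  set c := ln 2 ^+ k / k`!%:R in Imp *.
  apply: cplx_eq; rewrite !(ReB, ImB, Re_cj, Im_cj) mulrC ?ReZ ?ImZ/= -/(Im _) -/(Re _).
    by ring.
  by rewrite Imp; ring.
have R2 : 1 < Re ((2 : R)%:K : cplx R) by rewrite /= ltr1n.
have D1 := cts_seq (cder_cts (jump_derive k (lt_trans ltr01 R2))) C.
have D2 := cts_seq (cder_cts (cont_polylog_derive k R2)) C.
exact: (seq_cvgB (seq_cvgB P' D1) D2).
Qed.

End Continuation.

(** * Local branches and differentials on the plane of (u, v) *)

Section LocalLifts.
Variable R : realType.
Implicit Types (x y z a b c h : cplx R) (t : R) (w : cplx R * cplx R).

(** A holomorphic system of branches near an arbitrary point; the integer s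
    is the number of jumps between it and the principal branches. *)
Lemma local_branch (z0 : cplx R) : z0 != 0 -> z0 != 1 ->
  exists (F : nat -> cplx R -> cplx R) (s : cplx R -> int) (d : R), 0 < d /\
  forall z, normc (z - z0) < d ->
    [/\ z != 0, z != 1,
        forall k, F k z = polylog k z - (s z)%:~R * jump k z &
        forall k, is_derive z 1 (F k.+1) (F k z / z)].
Proof.
move=> z00 z01.
have n0 : 0 < normc z0 by rewrite normc_gt0.
have [Dz|nDz] := pselect (slit z0).
  have [d d0 H] := slit_open Dz.
  exists (@polylog R), (fun=> 0), (Num.min d (normc z0)).
  split=> [|z]; first by rewrite lt_min d0.
  rewrite lt_min => /andP[zd zn]; have {}Dz := H z zd.
  have zne0 : z != 0.
    by apply: contraTneq zn => ->; rewrite sub0r normcN ltxx.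
  split=> //.
  - by apply: contraTneq (slit1 Dz) => ->; rewrite subrr eqxx.
  - by move=> k; rewrite mul0r subr0.
  - move=> k; rewrite polylog_ray// mulrAC mulfV// mul1r.
    exact: polylog_derive.
have I0 : Im z0 = 0.
  by apply/eqP; apply: contra_notT nDz => ?; apply: slit_ReIm; right.
have R1 : 1 < Re z0.
  rewrite lt_neqAle; apply/andP; split.
    by apply: contra z01 => /eqP e; apply/eqP/cplx_eq; rewrite -?e// I0.
  by rewrite leNgt; apply: contra_notN nDz => ?; apply: slit_ReIm; left.
(* Otherwise z0 is real and greater than 1. *)
exists (@cont_polylog R), (fun z => if 0 < Im z then 1 else 0), (Re z0 - 1).
split=> [|z zd]; first by rewrite subr_gt0.
have z1 : 1 < Re z.
  by have := le_lt_trans (normRe_le _) zd; rewrite ReB ltr_norml => /andP[]; lra.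
split.
- exact: Re_gt1_neq0.
- by apply: contraTneq z1 => ->; rewrite /= ltxx.
- move=> k; have [Iz|Iz] := ltP 0 (Im z).
    by rewrite mul1r cont_polylog_upper.
  by rewrite mul0r subr0 cont_polylog_lower.
- by move=> k; exact: cont_polylog_derive.
Qed.

Lemma is_diff_cder (F : cplx R -> cplx R) (u l : cplx R) :
  is_derive u 1 F l -> is_diff u F (fun h => l * h).
Proof.
move=> [dF <-]; have dF' := (derivable1_diffP _ _).1 dF.
apply: DiffDef => //; rewrite diff1E//; apply/funext => h.
by rewrite /GRing.scale/= mulrC derive1E.
Qed.

Lemma is_diff_fst w : is_diff w fst fst.
Proof.
have cf : continuous (@fst (cplx R) (cplx R)) by move=> v; exact: cvg_fst.
by apply: DiffDef; [exact: linear_differentiable|rewrite diff_lin].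
Qed.

Lemma is_diff_snd w : is_diff w snd snd.
Proof.
have cf : continuous (@snd (cplx R) (cplx R)) by move=> v; exact: cvg_snd.
by apply: DiffDef; [exact: linear_differentiable|rewrite diff_lin].
Qed.

Definition lift_sum (F : nat -> cplx R -> cplx R) (e1 : cplx R) n u :=
  \sum_(0 <= r < n) (-1) ^+ r / r`!%:R * F (n - r)%N (e1 * cexp u) * u ^+ r.

(** The derivative of the r-th term is T_r - T_(r-1), where
    T_r = (-1)^r / r! F_(n-r) u^r: one part comes from F_(k+1)' = F_k / z and
    dz/du = z, the other from the power of u. *)
Lemma lift_sum_derive (F : nat -> cplx R -> cplx R) (e1 : cplx R) n u : e1 != 0 ->
  (forall k, is_derive (e1 * cexp u) 1 (F k.+1) (F k (e1 * cexp u) / (e1 * cexp u))) ->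
  is_derive u 1 (lift_sum F e1 n.+1)
    ((-1) ^+ n / n`!%:R * F 0 (e1 * cexp u) * u ^+ n).
Proof.
move=> e10 dF; set z := e1 * cexp u in dF *.
have z0 : z != 0 by rewrite mulf_neq0// cexp_neq0.
have dz : is_derive u 1 (fun v => e1 * cexp v) z := cderZ e1 (cexp_derive u).
pose T r := (-1) ^+ r / r`!%:R * F (n - r)%N z * u ^+ r.
pose U r := if r is r'.+1 then T r' else 0.
have H r : (r < n.+1)%N -> is_derive u 1
    (fun v => (-1) ^+ r / r`!%:R * F (n.+1 - r)%N (e1 * cexp v) * v ^+ r) (U r.+1 - U r).
  move=> rn; rewrite subSn//.
  have H1 := cderM (cderZ ((-1) ^+ r / r`!%:R) (cder_comp dz (dF (n - r)%N)))
    (cder_exp r (cder_id u)).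
  apply: (is_derive_eq H1); rewrite divfK// -/(T r) /U -/z; congr (_ + _).
  case: r rn {H1} => [|r] rn; first by rewrite !mul0r mulr0 oppr0.
  rewrite /T -(@subnSK r n)// factS natrM exprS.
  by field; rewrite nat1r !pnatr_eq0 -!lt0n fact_gt0.
have := cder_sum H; rewrite telescope_sumr// subr0 /U /T subnn.
exact.
Qed.

(** The effect on the sum of adding one jump to every Li_k. *)
Lemma binomial_jump n z u :
  \sum_(0 <= r < n.+1) (-1) ^+ r / r`!%:R * jump (n.+1 - r)%N z * u ^+ r =
  twopii R / n`!%:R * (cLog z - u) ^+ n.
Proof.
rewrite exprBn mulr_sumr big_mkord; apply: eq_bigr => r _.
have rn : (r <= n)%N by rewrite -ltnS.
rewrite subSn// /jump -[_ *+ 'C(n, r)]mulr_natr.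
have -> : 'C(n, r)%:R = n`!%:R / (r`!%:R * (n - r)`!%:R) :> cplx R.
  rewrite -(bin_fact rn) !natrM; field.
  by rewrite !pnatr_eq0 -!lt0n !fact_gt0.
by field; rewrite !pnatr_eq0 -!lt0n !fact_gt0.
Qed.

Lemma is_diff_lift (F : cplx R -> cplx R) (l c : cplx R) m w :
  is_derive w.1 1 F l ->
  is_diff w (fun x : cplx R * cplx R => F x.1 - c * x.1 ^+ m * x.2)
    (fun h : cplx R * cplx R => l * h.1 - (c * w.1 ^+ m * h.2 + w.2 * (c * (m%:R * w.1 ^+ m.-1) * h.1))).
Proof.
move=> dF.
have f1 := is_diff_fst w; have f2 := is_diff_snd w.
have dP : is_derive w.1 1 (fun u => c * u ^+ m) (c * (m%:R * w.1 ^+ m.-1 * 1)).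
  exact: (cderZ c (cder_exp m (cder_id _))).
have g1 : is_diff w (F \o fst) ((fun h => l * h) \o fst).
  exact: (is_diff_comp f1 (is_diff_cder dF)).
have g2 : is_diff w ((fun u => c * u ^+ m) \o fst)
    ((fun h => c * (m%:R * w.1 ^+ m.-1 * 1) * h) \o fst).
  exact: (is_diff_comp f1 (is_diff_cder dP)).
have g3 := is_diffB g1 (is_diffM g2 f2).
apply: (is_diff_eq g3); apply/funext => h /=.
by rewrite /= mulr1.
Qed.

End LocalLifts.

(** * Powers of odd integers modulo powers of two *)

Section Arithmetic.

Lemma int_odd_sqr_sub1 (m : int) a : (2 ^+ a.+1 %| m - 1)%Z ->
  (2 ^+ a.+2 %| m ^+ 2 - 1)%Z.
Proof.
move=> H; have -> : m ^+ 2 - 1 = (m - 1) * (m + 1) by ring.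
rewrite exprSr; apply: dvdz_mul => //.
have -> : m + 1 = (m - 1) + 2 by ring.
rewrite rpredD//; apply: dvdz_trans H.
by rewrite exprS dvdz_mulr.
Qed.

(** The square of 2 j + 1 is 1 + 4 j (j + 1), with j (j + 1) even, and
    each further squaring adds one factor 2. *)
Lemma int_odd_pow2_sub1 (j : int) a :
  (2 ^+ a.+3 %| (j * 2 + 1) ^+ (2 ^ a.+1) - 1)%Z.
Proof.
elim: a => [|a IH].
  rewrite expn1; have -> : (j * 2 + 1) ^+ 2 - 1 = 4 * (j * (j + 1)) by ring.
  have -> : 2 ^+ 3 = 4 * 2 :> int by [].
  apply: dvdz_mul => //; rewrite dvdzE/= abszM.
  case: j => j; first by rewrite -PoszD dvdn2 oddM /= oddD; case: (odd j).
  have -> : Negz j + 1 = - j%:Z by rewrite NegzE -addn1 PoszD; ring.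
  by rewrite abszN dvdn2 oddM /=; case: (odd j).
by rewrite expnSr exprM; exact: int_odd_sqr_sub1.
Qed.

(** Both m - 1 and, for k + 1 = 2^a b, m^(2^a) - 1 divide
    m^(k+1) - 1; here m = 2 j + 1. *)
Lemma int_odd_pow_sub1 (j : int) k : exists i : int,
  (j * 2 + 1) ^+ k.+1 - 1 =
    i * 2 ^+ (if odd k.+1 then 1 else 2 + logn 2 k.+1)%N.
Proof.
apply/dvdzP; case: ifP => [_|/negbT ek].
  rewrite subrX1; apply: dvdz_mulr; rewrite addrK; exact: dvdz_mull.
have l1 : (0 < logn 2 k.+1)%N by rewrite logn_gt0 mem_primes/= dvdn2.
have [b kE] := dvdnP (pfactor_dvdnn 2 k.+1).
move: l1 kE; set a := logn 2 k.+1 => l1 kE.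
rewrite kE mulnC exprM; set y := (j * 2 + 1) ^+ _.
rewrite subrX1; apply: dvdz_mulr; rewrite /y -(prednK l1).
exact: int_odd_pow2_sub1.
Qed.

End Arithmetic.

(** * Holomorphic lifts on the curve *)

Section Lift.
Variable R : realType.
Implicit Types z : cplx R.

(** Used with f(u) = e1 e^u, to stay near a given z along the curve. *)
Lemma near_curve (f : cplx R -> cplx R) (w : cplx R * cplx R) (d : R) :
  {for w.1, continuous f} -> 0 < d ->
  \forall x \near w, normc (f x.1 - f w.1) < d.
Proof.
move=> cf d0.
have cfst : {for w, continuous (@fst (cplx R) (cplx R))} by exact: cvg_fst.
have C : {for w, continuous (f \o fst)} by exact: (continuous_comp cfst cf).
apply: (C [set v | normc (v - f w.1) < d]).
by apply/nbhs_normcP; exists d.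
Qed.

Lemma polylogqE k z q : polylogq k.+1 z q = polylog k.+1 z - q%:~R * jump k.+1 z.
Proof. by rewrite /polylogq /jump /=; congr (_ - _); ring. Qed.

Lemma coordsP (e1 e2 : cplx R) (w : cplx R * cplx R) :
  e1 ^+ 2 = 1 -> e2 ^+ 2 = 1 -> hatC e1 e2 w ->
  [/\ (coords e1 e2 w).1.1 != 0, (coords e1 e2 w).1.1 != 1 &
      bracket e1 e2 (coords e1 e2 w) = w].
Proof.
move=> he1 he2 hw; have [x [Px _]] := (bracket_bij he1 he2).2 w hw.
rewrite /coords; set P := (X in xget _ X).
by have : P (xget (0, 0, 0) P) by apply: xgetPex; exists x.
Qed.

Lemma sqr1_neq0 (e : cplx R) : e ^+ 2 = 1 -> e != 0.
Proof. by move=> h; apply/eqP => e0; move: h; rewrite e0 expr0n => /eqP; rewrite eq_sym oner_eq0. Qed.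

Lemma bracket_zE (e1 e2 : cplx R) z (p q : int) (w : cplx R * cplx R) :
  e1 ^+ 2 = 1 -> z != 0 -> bracket e1 e2 (z, p, q) = w -> z = e1 * cexp w.1.
Proof.
move=> he1 z0 <-; have e10 := sqr1_neq0 he1.
by rewrite /= cexpD cexp_int mulr1 cLogK ?mulf_neq0// mulrA -expr2 he1 mul1r.
Qed.

Lemma tangentP (e1 e2 : cplx R) (w h : cplx R * cplx R) : tangent e1 e2 w h ->
  e1 * cexp w.1 * h.1 + e2 * cexp w.2 * h.2 = 0.
Proof.
rewrite /tangent/= => <-.
have g1 : is_diff w ((fun u => e1 * cexp u) \o fst)
    ((fun h => e1 * cexp w.1 * h) \o fst).
  exact: (is_diff_comp (is_diff_fst w) (is_diff_cder (cderZ e1 (cexp_derive w.1)))).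
have g2 : is_diff w ((fun u => e2 * cexp u) \o snd)
    ((fun h => e2 * cexp w.2 * h) \o snd).
  exact: (is_diff_comp (is_diff_snd w) (is_diff_cder (cderZ e2 (cexp_derive w.2)))).
have g := is_diffD g1 g2.
have -> : hatC_eq e1 e2 = ((fun u => e1 * cexp u) \o fst) + ((fun u => e2 * cexp u) \o snd).
  by apply/funext.
by rewrite diff_val.
Qed.

(** G is the function of the theorem with the local branches for the Li_k
    and with 0 for q.  The integer N is q minus the number of jumps.  When e2 = 1, the
    number 2 pi i N is F_1(z) + v, which is continuous. *)
Lemma lift_exists (e1 e2 : cplx R) n (w : cplx R * cplx R) :
  e1 ^+ 2 = 1 -> e2 ^+ 2 = 1 -> hatC e1 e2 w ->
  exists (G E : cplx R * cplx R -> cplx R) (N : cplx R * cplx R -> int),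
    [/\ {for w, continuous E},
        \forall x \near w, differentiable G x,
        \forall x \near w, hatC e1 e2 x ->
          hatL e1 e2 n.+2 x - G x = - (N x)%:~R *
            (twopii R / n.+1`!%:R * (cLog (coords e1 e2 x).1.1 - x.1) ^+ n.+1) /\
          (e2 = 1 -> E x = (N x)%:~R * twopii R) &
        \forall x \near w, hatC e1 e2 x -> forall h, tangent e1 e2 x h ->
          'd G x h = omega n.+2 x h].
Proof.
move=> he1 he2 hw; have e10 := sqr1_neq0 he1; have e20 := sqr1_neq0 he2.
have [z00 z01 bw] := coordsP he1 he2 hw.
have wz : (coords e1 e2 w).1.1 = e1 * cexp w.1.
  by apply: (@bracket_zE e1 e2 _ (coords e1 e2 w).1.2 (coords e1 e2 w).2) => //; rewrite -bw; case: (coords _ _ _) => -[].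
rewrite wz in z00 z01.
have [F [s [d [d0 Fd]]]] := local_branch z00 z01.
pose c0 : cplx R := (-1) ^+ n.+2 / n.+2`!%:R.
pose G (x : cplx R * cplx R) := lift_sum F e1 n.+2 x.1 - c0 * x.1 ^+ n.+1 * x.2.
pose E (x : cplx R * cplx R) := F 1%N (e1 * cexp x.1) + x.2.
pose N x := (coords e1 e2 x).2 - s (coords e1 e2 x).1.1.
have near_d : \forall x \near w, normc (e1 * cexp x.1 - e1 * cexp w.1) < d.
  apply: (near_curve (f := fun u => e1 * cexp u)) => //.
  exact: cder_cts (cderZ e1 (cexp_derive w.1)).
have dG (x : cplx R * cplx R) : normc (e1 * cexp x.1 - e1 * cexp w.1) < d ->
  is_diff x G (fun h => ((-1) ^+ n.+1 / n.+1`!%:R * F 0%N (e1 * cexp x.1) * x.1 ^+ n.+1) * h.1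
    - (c0 * x.1 ^+ n.+1 * h.2 + x.2 * (c0 * (n.+1%:R * x.1 ^+ n) * h.1))).
  move=> xd; have [_ _ _ FD] := Fd _ xd.
  exact: (is_diff_lift c0 n.+1 (lift_sum_derive n.+1 e10 FD)).
exists G, E, N; split.
- have [_ _ _ FD] := Fd _ (nbhs_singleton near_d).
  have cF : {for w.1, continuous (fun u => F 1%N (e1 * cexp u))}.
    exact: cder_cts (cder_comp (cderZ e1 (cexp_derive w.1)) (FD 0%N)).
  have cfst : {for w, continuous (@fst (cplx R) (cplx R))} by exact: cvg_fst.
  have csnd : {for w, continuous (@snd (cplx R) (cplx R))} by exact: cvg_snd.
  exact: (continuousD (continuous_comp cfst cF) csnd).
- by apply: filterS near_d => x /dG[].
- apply: filterS near_d => x xd hx.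
  have [z0 z1] := coordsP he1 he2 hx.
  rewrite /hatL /N; case: (coords e1 e2 x) z0 z1 => -[z p] q /= z0 z1 bx.
  have zE := bracket_zE he1 z0 bx; rewrite -zE in xd.
  have [_ _ FE _] := Fd _ xd; split.
    have -> : \sum_(0 <= r < n.+2) (-1) ^+ r / r`!%:R * polylogq (n.+2 - r) z q * x.1 ^+ r =
        lift_sum F e1 n.+2 x.1 - (q - s z)%:~R *
          \sum_(0 <= r < n.+2) (-1) ^+ r / r`!%:R * jump (n.+2 - r)%N z * x.1 ^+ r.
      rewrite /lift_sum -zE mulr_sumr -sumrB; apply: eq_big_nat => r /andP[_ rn].
      by rewrite subSn// polylogqE FE rmorphB; ring.
    by rewrite binomial_jump /G /c0; ring.
  move=> e21; rewrite /E -zE FE -bx e21 /= mul1r expr0 fact0 divr1 mulr1.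
  by rewrite rmorphB; ring.
- apply: filterS near_d => x xd hx h /tangentP th.
  have [_ _ FE _] := Fd _ xd.
  have -> : 'd G x h = (fun h : cplx R * cplx R =>
    ((-1) ^+ n.+1 / n.+1`!%:R * F 0%N (e1 * cexp x.1) * x.1 ^+ n.+1) * h.1
    - (c0 * x.1 ^+ n.+1 * h.2 + x.2 * (c0 * (n.+1%:R * x.1 ^+ n) * h.1))) h.
    by have D := dG x xd; rewrite diff_val.
  rewrite FE /= mulr0 subr0; move: hx th; rewrite /hatC/hatC_eq/= => hx th.
  set z := e1 * cexp x.1 in hx th *.
  have zE : 1 - z = e2 * cexp x.2 by rewrite -hx addrC addKr.
  have z1 : 1 - z != 0 by rewrite zE mulf_neq0// cexp_neq0.
  have K : z / (1 - z) * h.1 = - h.2.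
    apply: (mulfI z1); rewrite mulrN mulrA mulrCA mulfV// mulr1 zE.
    by apply/eqP; rewrite -addr_eq0 th.
  rewrite /omega /= subn2 /=.
  have -> : (-1) ^+ n.+1 / n.+1`!%:R * (z / (1 - z)) * x.1 ^+ n.+1 * h.1 =
     (-1) ^+ n.+1 / n.+1`!%:R * x.1 ^+ n.+1 * (z / (1 - z) * h.1) by ring.
  rewrite K /c0 [n.+2`!]factS natrM !exprS.
  by field; rewrite -natrD !pnatr_eq0 -!lt0n fact_gt0.
Qed.

End Lift.

(** * Comparison of the lifts with the function *)

Section Primitives.
Variable R : realType.
Implicit Types z : cplx R.

Lemma lift_shift (e1 e2 c k : cplx R) n (w : cplx R * cplx R)
    (G : cplx R * cplx R -> cplx R) :
  (\forall x \near w, differentiable G x) ->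
  (\forall x \near w, hatC e1 e2 x -> eqmodZ c (hatL e1 e2 n x) (G x + k)) ->
  (\forall x \near w, hatC e1 e2 x -> forall h, tangent e1 e2 x h ->
     'd G x h = omega n x h) ->
  exists2 G', holomorphic_lift e1 e2 c (hatL e1 e2 n) w G' &
    \forall x \near w, hatC e1 e2 x ->
      forall h, tangent e1 e2 x h -> 'd G' x h = omega n x h.
Proof.
move=> dG mG oG.
have D (x : cplx R * cplx R) : differentiable G x ->
    is_diff x (fun y => G y + k) ('d G x : _ -> _).
  move=> dx; have g0 : is_diff x G ('d G x) by apply: DiffDef.
  have g := is_diffD g0 (is_diff_cst k x).
  by apply: (is_diff_eq g); apply/funext => h /=; rewrite /= addr0.
exists (fun x => G x + k).
  by split=> //; apply: filterS dG => x /D[].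
apply: filterS2 dG oG => x dx ox hx h th.
have [_ Dx] := D x dx.
have Dh : 'd (fun y => G y + k) x h = 'd G x h := congr1 (fun f => f h) Dx.
exact: etrans Dh (ox hx h th).
Qed.

(** Here Log z - u = - 2 pi i p, and the comparison of
    [lift_exists] is an integer multiple of the modulus for every value of N. *)
Lemma primitive_hatL_pos (e2 : cplx R) n : e2 ^+ 2 = 1 ->
  primitive_mod 1 e2 (twopii R ^+ n.+2 / n.+1`!%:R) (hatL 1 e2 n.+2) (omega n.+2).
Proof.
move=> he2 w hw; have he1 : (1 : cplx R) ^+ 2 = 1 by rewrite expr1n.
have [G [E [N [_ dG nG oG]]]] := lift_exists n he1 he2 hw.
apply: (@lift_shift _ _ _ 0 _ _ G) => //.
apply: filterS nG => x H hx; have [{}H _] := H hx.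
have [z0 z1] := coordsP he1 he2 hx; move: H.
case: (coords 1 e2 x) z0 z1 => -[z p] q /= z0 z1 H bx.
exists (- N x * (- p) ^+ n.+1); rewrite addr0 H.
have -> : cLog z - x.1 = - p%:~R * twopii R by rewrite -bx /= mul1r; ring.
by rewrite exprMn [_ ^+ n.+2]exprS !rmorphM/= rmorphN rmorphXn/= rmorphN; ring.
Qed.

Lemma normc_intM_twopii (m : int) : normc (m%:~R * twopii R) < 2 * pi -> m = 0.
Proof.
rewrite normcM -[m%:~R](rmorph_int (real_complex R)) normcR.
have -> : normc (twopii R) = 2 * pi.
  by rewrite /= expr0n add0r sqrtr_sqr ger0_norm// mulr_ge0// pi_ge0.
rewrite -[ltRHS]mul1r ltr_pM2r ?mulr_gt0 ?pi_gt0//.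
rewrite -intr_norm -[1]/(1%:~R) ltr_int.
by move=> h; apply/eqP; rewrite -normr_eq0; lia.
Qed.

(** kappa_n is 2^(1-n) times the power of 2 of [int_odd_pow_sub1]. *)
Lemma kappaE n : kappa R n.+2 * 2 ^+ n.+1 =
  2 ^+ (if odd n.+1 then 1 else 2 + logn 2 n.+1)%N.
Proof.
have two0 : 2 != 0 :> cplx R by rewrite pnatr_eq0.
rewrite /kappa /= negbK; case: ifP => on /=;
  by rewrite !exprnP -expfzDr//; congr (_ ^ _); lia.
Qed.

Lemma cexp_half_period : cexp (twopii R / 2) = -1.
Proof.
have -> : twopii R / 2 = (0 +i* pi)%C.
  apply: (mulIf (_ : 2 != 0)); first by rewrite pnatr_eq0.
  by rewrite divfK ?pnatr_eq0// mulr_natr mulr2n; apply: cplx_eq; rewrite /= ?addr0//; ring.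
by rewrite /cexp /= expR0 cospi sinpi !mul1r; apply: cplx_eq; rewrite //= oppr0.
Qed.

(** Here Log z - u = m pi i with m odd, and N is locally constant.
    The lift is shifted by the value of the comparison for m = 1, so that what remains
    has the factor m^(n-1) - 1. *)
Lemma primitive_hatL_neg n :
  primitive_mod (-1) 1 (kappa R n.+2 * (twopii R ^+ n.+2 / n.+1`!%:R))
    (hatL (-1) 1 n.+2) (omega n.+2).
Proof.
move=> w hw; have he1 : (-1 : cplx R) ^+ 2 = 1 by rewrite sqrrN expr1n.
have he2 : (1 : cplx R) ^+ 2 = 1 by rewrite expr1n.
have [G [E [N [cE dG nG oG]]]] := lift_exists n he1 he2 hw.
pose X : cplx R := twopii R / n.+1`!%:R * (twopii R / 2) ^+ n.+1.
have nE : \forall x \near w, normc (E x - E w) < 2 * pi.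
  have pi2 : 0 < 2 * pi :> R by rewrite mulr_gt0// pi_gt0.
  apply: (cE [set v | normc (v - E w) < 2 * pi]).
  by apply/nbhs_normcP; exists (2 * pi).
apply: (@lift_shift _ _ _ (- (N w)%:~R * X) _ _ G) => //.
have [_ Ew] := nbhs_singleton nG hw.
apply: filterS2 nG nE => x H xE hx; have [{}H Ex] := H hx.
have NE : N x = N w.
  rewrite Ex// Ew// -mulrBl -rmorphB in xE.
  by apply/eqP; rewrite -subr_eq0; apply/eqP; exact: normc_intM_twopii xE.
have [z0 z1] := coordsP he1 he2 hx; move: H.
case: (coords (-1) 1 x) z0 z1 => -[z p] q /= z0 z1 H bx.
have [m zm] : exists m : int, cLog z - x.1 = (m * 2 + 1)%:~R * (twopii R / 2).
  have zE := bracket_zE he1 z0 bx.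
  have : cexp (cLog z) = cexp (x.1 + twopii R / 2).
    by rewrite cLogK// cexpD cexp_half_period {1}zE mulN1r mulrN1.
  move=> /cexp_eqP[m ->]; exists m; rewrite rmorphD rmorphM/=.
  by field.
have [i iE] := int_odd_pow_sub1 m n.
exists (- N w * i).
have -> : hatL (-1) 1 n.+2 x - (G x + - (N w)%:~R * X) =
   (hatL (-1) 1 n.+2 x - G x) + (N w)%:~R * X by ring.
rewrite H NE zm exprMn.
have -> : - (N w)%:~R * (twopii R / n.+1`!%:R * ((m * 2 + 1)%:~R ^+ n.+1 * (twopii R / 2) ^+ n.+1)) +
  (N w)%:~R * X = - (N w)%:~R * ((m * 2 + 1)%:~R ^+ n.+1 - 1) * X by rewrite /X; ring.
have -> : ((m * 2 + 1)%:~R ^+ n.+1 - 1 : cplx R) = i%:~R * (kappa R n.+2 * 2 ^+ n.+1).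
  by rewrite kappaE -[1 in LHS]/(1%:~R) -rmorphXn -rmorphB iE rmorphM rmorphXn.
rewrite /X expr_div_n rmorphM rmorphN [_ ^+ n.+2]exprS.
by field; rewrite expf_neq0 ?pnatr_eq0 ?andbT// -lt0n fact_gt0.
Qed.

Lemma primitive_holomorphic (e1 e2 c : cplx R) f om :
  primitive_mod e1 e2 c f om -> holomorphic_mod e1 e2 c f.
Proof. by move=> H w /H[G HG _]; exists G. Qed.

End Primitives.

Theorem theorem2p2 (R : realType) (n : nat) (hn : (2 <= n)%N) :
  let c : cplx R := twopii R ^+ n / (n.-1)`!%:R in
  [/\ holomorphic_mod 1 1 c (hatL 1 1 n),
      holomorphic_mod 1 (-1) c (hatL 1 (-1) n) &
      holomorphic_mod (-1) 1 (kappa R n * c) (hatL (-1) 1 n)] /\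
  [/\ primitive_mod 1 1 c (hatL 1 1 n) (omega n),
      primitive_mod 1 (-1) c (hatL 1 (-1) n) (omega n) &
      primitive_mod (-1) 1 (kappa R n * c) (hatL (-1) 1 n) (omega n)].
Proof.
case: n hn => [|[|n]]// _ c.
have P1 : primitive_mod 1 1 c (hatL 1 1 n.+2) (omega n.+2).
  by apply: primitive_hatL_pos; rewrite expr1n.
have P2 : primitive_mod 1 (-1) c (hatL 1 (-1) n.+2) (omega n.+2).
  by apply: primitive_hatL_pos; rewrite sqrrN expr1n.
have P3 := @primitive_hatL_neg R n.
by split; split => //; [exact: primitive_holomorphic P1|exact: primitive_holomorphic P2|exact: primitive_holomorphic P3].
Qed.
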